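(* Let $f\in L_p(\mathbb{T})$, $1\le p<\infty$, $r,s\in\mathbb{N}$ with $s\le 2r$, and let $(G_n)_{n\in\mathbb{N}}$ be a family of linear sampling operators with nodes $X_n=(x_{k,n})_{k=1}^n$ and separation constant $\gamma\in(0,1]$ (see context). Suppose that there are constants $K_1,K_2,K_3>0$ such that $$K_2\|g\|_{\ell_p(X_n)}\le\|G_n(g)\|_p\le K_1\|g\|_{\ell_p(X_n)}\quad\text{for all } g\in L_p(\mathbb{T}),\ n\in\mathbb{N},$$ $$\|g-G_n(g)\|_p\le K_3n^{-s}\|g^{(s)}\|_p\quad\text{for all } g\in W_p^s(\mathbb{T}),\ n\in\mathbb{N}.$$ If $$\omega_s(f,1/n)_p=o\big(\|f_{\gamma/n,\,r}-f\|_{\ell_p(X_n)}\big)\quad\text{as } n\to\infty,$$ then $\|f-G_n(f)\|_p$ has exact order $\|f_{\gamma/n,\,r}-f\|_{\ell_p(X_n)}$, that is, there exist constants $c,C>0$ and $n_0\in\mathbb{N}$ such that for all $n\ge n_0$ $$c\,\|f_{\gamma/n,\,r}-f\|_{\ell_p(X_n)}\le\|f-G_n(f)\|_p\le C\,\|f_{\gamma/n,\,r}-f\|_{\ell_p(X_n)} .$$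
   Context: $\mathbb{T}=[0,1)$. For $1\le p<\infty$, $L_p(\mathbb{T})$ is the space of all 1-periodic measurable functions $f$, finite at every point, with $\|f\|_p=(\int_0^1|f(x)|^p\,dx)^{1/p}<\infty$; functions coinciding almost everywhere are not identified, so $f\in L_p(\mathbb{T})$ is given by its value at each point. For $s\in\mathbb{N}$, $f\in W_p^s(\mathbb{T})$ means that $f$ is 1-periodic, $f^{(s-1)}$ is absolutely continuous and $f^{(s)}\in L_p(\mathbb{T})$. For a set of $n$ points $X_n=(x_{k,n})_{k=1}^n$, $\|f\|_{\ell_p(X_n)}=\big(\frac1n\sum_{k=1}^n|f(x_{k,n})|^p\big)^{1/p}$. Modulus of smoothness: for $s\in\mathbb{N}$, $\delta>0$, $\omega_s(f,\delta)_p=\sup_{0<h<\delta}\|\Delta_h^sf\|_p$, where $\Delta_h^sf(x)=\sum_{\nu=0}^s\binom{s}{\nu}(-1)^\nu f(x+(s-\nu)h)$. Generalized Steklov average: for $r\in\mathbb{N}$, $\delta>0$ and integrable $f$, $$f_{\delta,r}(x)=(-1)^{r+1}\binom{2r}{r}^{-1}\frac2\delta\int_{-\delta/2}^{\delta/2}\sum_{\nu=0}^{r-1}(-1)^\nu\binom{2r}{\nu}f\Big(x+\frac{r-\nu}{r}t\Big)dt .$$ Sampling operators: for each $n\in\mathbb{N}$, $G_n(f)(x)=\sum_{k=1}^nf(x_{k,n})\varphi_{k,n}(x)$, where $\varphi_{k,n}\in L_p(\mathbb{T})$ are fixed 1-periodic functions and the nodes $X_n=(x_{k,n})_{k=1}^n$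 satisfy $0\le x_{1,n}<x_{2,n}<\dots<x_{n,n}<1$. It is assumed that $\gamma\in(0,1]$ is such that $\min_{1\le k\le n}(x_{k+1,n}-x_{k,n})\ge\gamma/n$ for all $n\in\mathbb{N}$, where $x_{n+1,n}=1+x_{1,n}$. *)

(* Defs.v *)
From HB Require Import structures.
From mathcomp Require Import all_boot all_order all_algebra.
From mathcomp Require Import all_classical all_reals all_analysis.

Set Implicit Arguments.
Unset Strict Implicit.
Unset Printing Implicit Defensive.

Import Order.TTheory GRing.Theory Num.Theory.
Import numFieldNormedType.Exports.

Local Open Scope classical_set_scope.
Local Open Scope ring_scope.

(* [R] with its Lebesgue (Caratheodory) measurable sets, the domain of
   [completed_lebesgue_measure]; the canonical structure on [R] itself only
   has the Borel sets. The elements of L_p(T) are functions and not classes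
   modulo a.e. equality, so restricting to Borel functions would be a genuine
   loss. *)
Definition lebesgueType (R : realType) : measurableType _ :=
  caratheodory_type ((@wlength R idfun)^*)%mu.

Section defs.
Context {R : realType}.
Implicit Types (p delta : R) (f : R -> R) (r s n : nat) (x : nat -> nat -> R).

Local Notation leb := (@completed_lebesgue_measure R).

Definition Lp_enorm p f : \bar R :=
  Lnorm leb p%:E (EFin \o (f \* \1_(`[0, 1[))%R).

(* To be used only on functions for which [Lp_enorm] is finite. *)
Definition Lp_norm p f : R := fine (Lp_enorm p f).

Definition in_Lp p f : Prop :=
  [/\ measurable_fun [set: lebesgueType R] (f : lebesgueType R -> R),
      periodic f 1 & (Lp_enorm p f < +oo)%E].

Definition absolutely_continuous (a b : R) f : Prop :=
  forall eps : R, 0 < eps -> exists2 delta : R, 0 < delta &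
    forall (m : nat) (u v : 'I_m -> R),
      (forall i, [/\ a <= u i, u i <= v i & v i <= b]) ->
      trivIset setT (fun i => `]u i, v i[%classic) ->
      \sum_(i < m) (v i - u i) < delta ->
      \sum_(i < m) `|f (v i) - f (u i)| < eps.

(* [f^`(k)] is a total function, equal to 0 wherever the limit of the
   difference quotients does not exist: hence the explicit differentiability
   clause for the orders below [s]. For the order [s], the derivative exists
   a.e. by absolute continuity of [f^`(s.-1)]. By periodicity it is enough to
   have absolute continuity on one period. *)
Definition in_W p s f : Prop :=
  [/\ periodic f 1,
      forall k, (k < s.-1)%N -> forall t, derivable (f^`(k))%classic t 1,
      absolutely_continuous 0 1 (f^`(s.-1))%classic &
      in_Lp p (f^`(s))%classic].

Definition finite_diff s (h : R) f : R -> R := fun t =>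
  \sum_(nu < s.+1) 'C(s, nu)%:R * (-1) ^+ nu * f (t + (s - nu)%:R * h).

Definition smoothness s p f delta : R :=
  sup [set Lp_norm p (finite_diff s h f) | h in `]0, delta[].

Definition steklov delta r f : R -> R := fun t =>
  (-1) ^+ r.+1 * ('C(2 * r, r)%:R)^-1 * (2 / delta) *
  \int[leb]_(u in `[- (delta / 2), delta / 2])
    \sum_(nu < r) (-1) ^+ nu * 'C(2 * r, nu)%:R * f (t + (r - nu)%:R / r%:R * u).

(* The node x_{k,n} is [x n k], and likewise for phi_{k,n}; only the indices
   1 <= k <= n matter, together with the convention
   [x n n.+1 = 1 + x n 1] in [separated_nodes]. *)

Definition lp_norm p x n f : R :=
  (n%:R^-1 * \sum_(1 <= k < n.+1) `|f (x n k)| `^ p) `^ p^-1.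

Definition sampling x (phi : nat -> nat -> R -> R) n f : R -> R := fun t =>
  \sum_(1 <= k < n.+1) f (x n k) * phi n k t.

Definition separated_nodes (gamma : R) x : Prop :=
  forall n, (0 < n)%N ->
    [/\ 0 <= x n 1%N,
        forall k, (1 <= k < n)%N -> x n k < x n k.+1,
        x n n < 1,
        x n n.+1 = 1 + x n 1%N &
        forall k, (1 <= k <= n)%N -> gamma / n%:R <= x n k.+1 - x n k].

End defs.

(* Main.v *)
Require Import Defs.
From mathcomp Require Import all_boot all_order all_algebra.
From mathcomp Require Import all_classical all_reals all_analysis.
From mathcomp Require Import measurable_realfun ring lra zify.
Import Order.TTheory GRing.Theory Num.Theory.
Import numFieldNormedType.Exports.
Set Implicit Arguments.
Unset Strict Implicit.
Unset Printing Implicit Defensive.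
Local Open Scope classical_set_scope.
Local Open Scope ring_scope.

(** Write [G] for the [n]-th sampling operator, [F] for the Steklov average of
    [f] with step [delta = gamma / n] and [omega] for [smoothness s p f n^-1].
    The proof compares [f] with one smooth function [g], depending on [n], such
    that, up to constant factors that do not depend on [n],
    - the [L_p] norm of [f - g] is at most [omega];
    - the [L_p] norm of the [s]-th derivative of [g] is at most [n ^ s * omega];
    - the discrete norm of [F - g] on the nodes is at most [omega].
    From [f - G f = (f - g) + (g - G g) + G (g - f)], the error estimate applied
    to [g] and the two-sided bound applied to [g - f], the norm of [f - G f] is
    the discrete norm of [g - f] up to factors [K1], [K2] and a multiple of
    [omega]; by the third property this discrete norm is that of [F - f], again
    up to a multiple of [omega]. As [omega] is negligible with respect to the
    discrete norm of [F - f], it is absorbed. The average [F] is only evaluated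
    at the nodes.

    Construction of [g]. Let [average a] be the operator that averages a
    function over [x, x + a], let [m = s + 1] and [h = 1 / ((m + 1) n)].
    Replacing the step [t] of the finite difference of order [m] by
    [h (t_1 + ... + t_m)] and averaging over all [t_j] in [0, 1] turns
    the shift of [f] by [(m - i) t] into the [m]-fold iterate of
    [average ((m - i) h)]. The term [i = m] is [f] itself, up to sign, and the
    others make up [- g] ([smoothing]). Hence [f - g] is, up to sign, an average
    of differences of order [m] of [f], and its norm is at most [2 omega]
    ([smoothing_error_le]). Each derivative of [average a u] is a difference
    quotient of [u], so the [s]-th derivative of [g] is a combination of
    differences of order [s] of [average a f] divided by [a ^ s]
    ([Lp_enorm_smoothing_le]). One averaging more than the [s] that
    differentiation consumes makes this [s]-th derivative continuous, and every
    derivative is then given by the fundamental theorem of calculus for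
    continuous functions, at every point.

    Values at the nodes. The Steklov average of [f - g] at [t] is bounded, up
    to a constant factor, by the mean of [|f - g|] over the interval of length
    [delta] centred at [t] ([steklov_bound]). The difference between the Steklov average of [g] and [g]
    is a mean of central differences of order [2 r >= s] of [g], hence is bounded
    by a multiple of [delta ^ s] times the mean of [|g^(s)|] over the same interval
    ([steklov_smooth_error]). The intervals of length [gamma / n] centred at the
    nodes do not overlap, so Jensen's inequality bounds the discrete norm of
    such local means by the [L_p] norm ([lp_norm_le_local_mean]).

    Tonelli's theorem and the invariance properties are applied to Borel
    functions and Lebesgue measure on the Borel sets; [f], which is only
    Lebesgue measurable, is therefore replaced by a periodic Borel function
    [f0] that is equal to it almost everywhere ([borel_representative]). The
    values of [f] at the nodes only enter through [f] itself. *)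

(** * Lebesgue measure under affine maps *)

Lemma measurable_affine (R : realType) (a b : R) (D : set R) :
  measurable_fun D (fun x : R => a * x + b).
Proof. by apply: measurable_funD => //; exact: mulrl_measurable. Qed.

Lemma preimage_affine_ocitv (R : realType) (a b u v : R) : a != 0 -> 
  @lebesgue_measure R ((fun x : R => (a * x + b)%R) @^-1` `]u, v]) =
   (`|a|^-1%:E * @lebesgue_measure R `]u, v])%E.
Proof.
move=> a0; have [a_gt0|a_lt0|a00] := ltgtP a 0; last by rewrite a00 eqxx in a0.
- have -> : (fun x => a * x + b) @^-1` `]u, v] = `[(v - b) / a, (u - b) / a[%classic.
    apply/seteqP; split => x /=; rewrite !in_itv/= ler_ndivrMr// ltr_ndivlMr//.
      by move=> /andP[? ?]; apply/andP; split; lra.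
    by move=> /andP[? ?]; apply/andP; split; lra.
  rewrite !lebesgue_measure_itv/= !lte_fin ltr_nM2r ?invr_lt0// ltrD2r; case: ifPn; last by rewrite mule0.
  move=> _; rewrite -EFinB -EFinM; congr EFin; rewrite ltr0_norm//; field; done.
- have -> : (fun x => a * x + b) @^-1` `]u, v] = `](u - b) / a, (v - b) / a]%classic.
    apply/seteqP; split => x /=; rewrite !in_itv/= ler_pdivlMr// ltr_pdivrMr//.
      by move=> /andP[? ?]; apply/andP; split; lra.
    by move=> /andP[? ?]; apply/andP; split; lra.
  rewrite !lebesgue_measure_itv/= !lte_fin ltr_pM2r ?invr_gt0// ltrD2r; case: ifPn; last by rewrite mule0.
  move=> _; rewrite -EFinB -EFinM; congr EFin; rewrite gtr0_norm//; field; done.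
Qed.

Lemma lebesgue_measure_affine (R : realType) (a b : R) (A : set R) :
  a != 0 -> measurable A ->
  (`|a|%:E * @lebesgue_measure R ((fun x : R => (a * x + b)%R) @^-1` A) =
  @lebesgue_measure R A)%E.
Proof.
move=> a0 mA.
pose phi := (fun x : R => a * x + b) : measurableTypeR R -> measurableTypeR R.
have mphi : measurable_fun setT phi := @measurable_affine R a b setT.
have na : (0 <= `|a|) by [].
pose nu := mscale (NngNum na) (pushforward (@lebesgue_measure R) phi).
rewrite -[LHS]/(nu mphi A).
apply/esym; apply: (@lebesgue_measure_unique R (nu mphi)) => // X [[u v] _ <-] /=.
rewrite /nu /mscale/= /pushforward preimage_affine_ocitv//.
by rewrite muleA -EFinM mulfV ?normr_eq0// mul1e.
Qed.

Lemma ge0_integral_affine (R : realType) (a b : R) (D : set R) (f : R -> \bar R) :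
  a != 0 -> measurable D -> measurable_fun setT f -> (forall x, 0 <= f x)%E ->
  (\int[@lebesgue_measure R]_(x in (fun x : R => (a * x + b)%R) @^-1` D) f (a * x + b)%R =
  `|a|^-1%:E * \int[@lebesgue_measure R]_(x in D) f x)%E.
Proof.
move=> a0 mD mf f0.
pose phi := (fun x : R => a * x + b) : measurableTypeR R -> measurableTypeR R.
have mphi : measurable_fun setT phi := @measurable_affine R a b setT.
have na : (0 <= `|a|) by [].
pose nu := mscale (NngNum na) (pushforward (@lebesgue_measure R) phi).
have -> : (\int[@lebesgue_measure R]_(x in D) f x = \int[nu mphi]_(x in D) f x)%E.
  apply: eq_measure_integral => A mA AD /=.
  by rewrite -(@lebesgue_measure_affine _ a b). 
rewrite ge0_integral_mscale//; last exact: measurable_funTS.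
rewrite ge0_integral_pushforward//; last exact: measurable_funTS.
by rewrite muleA -EFinM mulVf ?normr_eq0// mul1e.
Qed.

(** * Lebesgue measurable functions and Borel functions *)

(** The identity from the completed space to the Borel space is measurable and
    pushes the completed measure forward to Lebesgue measure. *)
Lemma ge0_integral_completed (R : realType) (D : set R) (f : R -> \bar R) :
  measurable D -> measurable_fun setT f -> (forall x, 0 <= f x)%E ->
  (\int[@completed_lebesgue_measure R]_(x in D) f x =
   \int[@lebesgue_measure R]_(x in D) f x)%E.
Proof.
move=> mD mf f0.
pose phi := (fun x => x) : lebesgueType R -> measurableTypeR R.
have mphi : measurable_fun setT phi.
  move=> _ A mA; rewrite setTI; exact: sub_caratheodory.
have := @ge0_integral_pushforward _ _ _ _ _ _ mphi (@completed_lebesgue_measure R) D f mD.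
move=> <- //; last exact: measurable_funTS.
Qed.

Lemma integral_completed (R : realType) (D : set R) (f : R -> \bar R) :
  measurable D -> measurable_fun setT f ->
  (\int[@completed_lebesgue_measure R]_(x in D) f x =
   \int[@lebesgue_measure R]_(x in D) f x)%E.
Proof.
move=> mD mf; rewrite integralE [RHS]integralE; congr (_ - _)%E; apply: ge0_integral_completed => //.
  exact: measurable_funepos.
exact: measurable_funeneg.
Qed.

(** Lebesgue measurable sets are those of the completed Borel algebra; the
    null part is enlarged here to a Borel null set. *)
Lemma measurable_lebesgue_decomp (R : realType) (A : set R) :
  measurable (A : set (lebesgueType R)) ->
  exists B N : set R, [/\ measurable B, measurable N, @lebesgue_measure R N = 0%E,
    B `<=` A & A `<=` B `|` N].
Proof.
move=> mA.
have : completed_algebra_gen (@lebesgue_measure R) A.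
  rewrite -g_sigma_completed_algebra_genE completed_caratheodory_measurable; exact: mA.
case=> B /= mB [M [N [mN N0 MN]]] <-.
by exists B, N; split => //; exact: setUS.
Qed.

(** Indexing the union by the integers as well as the rationals makes the set
    invariant under the shift by 1, which is what lets the Borel representative
    below remain periodic. *)
Lemma null_bigcup_shift (R : realType) (N : rat -> set R) :
  (forall q, measurable (N q)) -> (forall q, @lebesgue_measure R (N q) = 0%E) ->
  let M := [set x : R | exists q : rat, exists z : int, N q (x + z%:~R)] in
  measurable M /\ @lebesgue_measure R M = 0%E.
Proof.
move=> mN N0 M.
(* The pairs are enumerated by naturals to stay within countable unions. *)
pose F (k : nat) := if @unpickle (rat * int)%type k is Some (q, z)
  then (fun x : R => 1 * x + z%:~R) @^-1` N q else set0.
have mF k : measurable (F k).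
  rewrite /F; case: unpickle => [[q z]|//].
  by rewrite -[X in measurable X]setTI; apply: measurable_affine.
have F0 k : @lebesgue_measure R (F k) = 0%E.
  rewrite /F; case: unpickle => [[q z]|]; last by rewrite measure0.
  have := @lebesgue_measure_affine R 1 z%:~R (N q) (oner_neq0 _) (mN q).
  by rewrite normr1 mul1e N0.
have FE q z : F (pickle (q, z)) = (fun x : R => 1 * x + z%:~R) @^-1` N q.
  by rewrite /F pickleK.
have -> : M = \bigcup_k F k.
  apply/seteqP; split => [x [q [z Nx]]|x [k _ Fx]].
    move: (FE q z); move: (pickle _) => k Fk.
    by exists k; [exact: I | rewrite Fk /= mul1r].
  move: Fx; rewrite /F; case: unpickle => [[q z]|//] /=; rewrite mul1r => ?.
  by exists q, z.
split; first exact: bigcupT_measurable.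
apply/negligibleP; first exact: bigcupT_measurable.
apply: negligible_bigcup => k; apply/negligibleP; first exact: mF.
exact: F0.
Qed.

(** Each rational sublevel set of [f] is a Borel set up to a null set. Setting
    the function to 0 on the union [M] of all these null sets and of their
    integer translates gives a function whose sublevel sets are Borel. *)
Lemma borel_representative (R : realType) (f : R -> R) :
  measurable_fun [set: lebesgueType R] (f : lebesgueType R -> R) -> periodic f 1 ->
  exists (f0 : R -> R) (M : set R), [/\ measurable_fun [set: R] f0, periodic f0 1,
    measurable M, @lebesgue_measure R M = 0%E & forall x, ~ M x -> f x = f0 x].
Proof.
move=> mf pf.
have mA (q : rat) : measurable (f @^-1` `]-oo, ratr q[ : set (lebesgueType R)).
  rewrite -[X in measurable X]setTI; apply: mf => //.
pose B q := sval (cid (measurable_lebesgue_decomp (mA q))).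
pose N q := sval (cid (svalP (cid (measurable_lebesgue_decomp (mA q))))).
have BN q : [/\ measurable (B q), measurable (N q), @lebesgue_measure R (N q) = 0%E,
    B q `<=` f @^-1` `]-oo, ratr q[ & f @^-1` `]-oo, ratr q[ `<=` B q `|` N q].
  by rewrite /B /N; case: (cid _) => b /= ?; case: (cid _).
have mB q := let: And5 h _ _ _ _ := BN q in h.
have mN q := let: And5 _ h _ _ _ := BN q in h.
have N0 q := let: And5 _ _ h _ _ := BN q in h.
have Bf q := let: And5 _ _ _ h _ := BN q in h.
have fB q := let: And5 _ _ _ _ h := BN q in h.
have [mM M0] := null_bigcup_shift mN N0.
set M := (X in measurable X) in mM M0.
have Mshift x : M (x + 1) <-> M x.
  split=> -[q [z Nx]]; [exists q, (z + 1)|exists q, (z - 1)].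
    by rewrite (_ : x + _ = x + 1 + z%:~R)// rmorphD/=; ring.
  by rewrite (_ : x + 1 + _ = x + z%:~R)// rmorphB/=; ring.
exists (fun x => if `[< M x >] then 0 else f x), M; split => //.
- apply: (measurability _ (RGenInftyO.measurableE R)) => _ [_ [y ->] <-]; rewrite setTI.
  have -> : (fun x => if `[< M x >] then 0 else f x) @^-1` `]-oo, y[ =
     ((\bigcup_(q in [set q : rat | ratr q < y]) B q) `\` M) `|`
      (M `&` (if 0 < y then setT else set0)).
    apply/seteqP; split => x /=; rewrite in_itv/=.
      case: asboolP => [Mx y0|nMx fy]; first by right; rewrite y0.
      left; split=> //.
      have [q] := rat_in_itvoo fy; rewrite in_itv/= => /andP[fq qy].
      exists q => //.
      have /fB[//|Nq] : (f @^-1` `]-oo, ratr q[) x by rewrite /= in_itv.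
      exfalso; apply: nMx; exists q, 0; by rewrite addr0.
    case=> [[[q /= qy Bx] nMx]|[Mx]].
      rewrite asboolF//.
      by have := Bf q x Bx; rewrite /= in_itv/= => /lt_trans; apply.
    by rewrite asboolT//; case: ifPn.
  apply: measurableU; last by apply: measurableI => //; case: ifPn.
  apply: measurableD => //.
  rewrite bigcup_mkcond; apply: bigcupT_measurable_rat => q.
  by case: ifPn.
- move=> x; case: asboolP => [/Mshift Mx|nMx]; first by rewrite asboolT.
  by rewrite asboolF// => /Mshift.
- by move=> x nMx; rewrite asboolF.
Qed.

(** * Norms over a period *)

Section Lnorm_on.
Context d (T : measurableType d) (R : realType).
Variables (mu : {measure set T -> \bar R}) (D : set T).
Hypothesis mD : measurable D.
Implicit Types (p c : R) (f g : T -> R).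
Local Notation N p f := (Lnorm mu p%:E (EFin \o (f \* \1_D)%R)).

Lemma measurable_powR_norm p f (E : set T) : measurable_fun E f ->
  measurable_fun E (fun x => (`|f x| `^ p)%:E).
Proof.
move=> mf; apply/measurable_EFinP.
apply: (measurableT_comp (measurable_powR p)).
exact: measurableT_comp.
Qed.

(** Cutting [f] by the indicator of [D] is how [Lp_enorm] restricts the norm
    to a period; all facts on [Lp_enorm] are obtained from this section with
    [D] the period and the measure either completed or not. *)
Lemma Lnorm_onE p f : 0 < p ->
  (N p f = (\int[mu]_(x in D) (`|f x| `^ p)%:E) `^ p^-1)%E.
Proof.
move=> p0; rewrite [in RHS]integral_mkcond unlock.
apply: (congr1 (fun y => y `^ p^-1)%E); apply: eq_integral => x _ /=.
rewrite patchE indicE; case: ifPn => _; first by rewrite mulr1.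
by rewrite mulr0 normr0 powR0// gt_eqF.
Qed.

Lemma Lnorm_on_ae p f g : 0 < p ->
  measurable_fun setT f -> measurable_fun setT g ->
  {ae mu, forall x, f x = g x} -> N p f = N p g.
Proof.
move=> p0 mf mg fg; rewrite (Lnorm_onE f p0) (Lnorm_onE g p0).
apply: (congr1 (fun y => y `^ p^-1)%E).
apply: ae_eq_integral => //.
- by apply: measurable_powR_norm; apply: measurable_funTS.
- by apply: measurable_powR_norm; apply: measurable_funTS.
- have [M [mM M0 MP]] := fg; exists M; split => //.
  by apply: subset_trans MP => x /= H fgx; apply: H => _; rewrite fgx.
Qed.

Lemma measurable_cut f : measurable_fun setT f -> measurable_fun setT (f \* \1_D).
Proof. by move=> mf; apply: measurable_funM => //; exact: measurable_indic. Qed.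

Lemma Lnorm_onD p f g : 1 <= p ->
  measurable_fun setT f -> measurable_fun setT g ->
  (N p (f \+ g)%R <= N p f + N p g)%E.
Proof.
move=> p1 mf mg.
rewrite (_ : (f \+ g) \* \1_D = (f \* \1_D) \+ (g \* \1_D)); last first.
  by apply/funext => x /=; rewrite mulrDl.
by apply: minkowski_EFin => //; exact: measurable_cut.
Qed.

Lemma Lnorm_onZ p c f : 0 < p -> measurable_fun setT f ->
  (N p (fun x => c * f x)%R = `|c|%:E * N p f)%E.
Proof.
move=> p0 mf; rewrite (Lnorm_onE f p0) (Lnorm_onE (fun x => c * f x) p0).
under eq_integral do rewrite normrM powRM// EFinM.
rewrite ge0_integralZl//.
- rewrite poweRM ?lee_fin ?powR_ge0//; last first.
    by apply: integral_ge0 => x _; rewrite lee_fin powR_ge0.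
  by rewrite poweR_EFin -powRrM mulfV ?gt_eqF// powRr1.
- by apply: measurable_powR_norm; apply: measurable_funTS.
Qed.

Lemma Lnorm_on_sum p (I : Type) (r : seq I) (F : I -> T -> R) : 1 <= p ->
  (forall i, measurable_fun setT (F i)) ->
  (N p (fun x => \sum_(i <- r) F i x)%R <= \sum_(i <- r) N p (F i))%E.
Proof.
move=> p1 mF; have p0 : 0 < p by exact: lt_le_trans p1.
elim: r => [|i r IH].
  rewrite big_nil (_ : (fun x => _) \* _ = cst 0); first by rewrite Lnorm0// eqe gt_eqF.
  by apply/funext => x; rewrite /= big_nil mul0r.
rewrite big_cons (_ : (fun x => _) = F i \+ (fun x => \sum_(j <- r) F j x)); last first.
  by apply/funext => x; rewrite big_cons.
apply: le_trans (Lnorm_onD p1 _ _) _ => //; last exact: leeD2l.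
exact: measurable_sum.
Qed.

End Lnorm_on.

Section Lp.
Context {R : realType}.
Implicit Types (p c : R) (f g : R -> R).
Local Notation leb := (@completed_lebesgue_measure R).
Local Notation mu := (@lebesgue_measure R).
Local Notation lmeasurable f := (measurable_fun [set: lebesgueType R] (f : lebesgueType R -> R)).

Lemma borel_lmeasurable f : measurable_fun [set: R] f -> lmeasurable f.
Proof.
move=> mf _ A mA; rewrite setTI; apply: sub_caratheodory.
by rewrite -[X in _ X]setTI; apply: mf.
Qed.

Lemma ae_lmeasurable f g : measurable_fun [set: R] g ->
  {ae mu, forall x, f x = g x} -> lmeasurable f.
Proof.
move=> mg [N [mN N0 NP]].
apply/(measurable_EFinP).
apply: (@ae_measurable_fun _ _ _ leb completed_lebesgue_measure_is_complete _ (EFin \o g)).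
  exists N; split => //; first exact: sub_caratheodory.
  by apply: subset_trans NP => x /= H fg; apply: H => _ /=; rewrite fg.
by apply/measurable_EFinP; exact: borel_lmeasurable.
Qed.

Lemma ae_completed (P : R -> Prop) : {ae mu, forall x, P x} -> {ae leb, forall x, P x}.
Proof. by move=> [N [mN N0 NP]]; exists N; split => //; exact: sub_caratheodory. Qed.

Let mD : measurable (`[0, 1[%classic : set (lebesgueType R)).
Proof. exact: sub_caratheodory. Qed.

(** For Borel functions the norm is an integral for Lebesgue measure on the
    Borel sets, for which the change of variables and Tonelli's theorem hold. *)
Lemma Lp_enormE p f : 0 < p -> measurable_fun setT f ->
  (Lp_enorm p f = (\int[mu]_(x in `[0%R, 1%R[) (`|f x| `^ p)%:E) `^ p^-1)%E.
Proof.
move=> p0 mf; rewrite /Lp_enorm (Lnorm_onE leb `[0, 1[ f p0).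
rewrite ge0_integral_completed//.
- exact: measurable_powR_norm.
Qed.

Lemma Lp_enorm_ae p f g : 0 < p -> measurable_fun [set: R] g ->
  {ae mu, forall x, f x = g x} -> Lp_enorm p f = Lp_enorm p g.
Proof.
move=> p0 mg fg; apply: (Lnorm_on_ae mD p0); last exact: ae_completed.
- exact: ae_lmeasurable fg.
- exact: borel_lmeasurable.
Qed.

Lemma Lp_enormD p f g : 1 <= p -> lmeasurable f -> lmeasurable g ->
  (Lp_enorm p (f \+ g)%R <= Lp_enorm p f + Lp_enorm p g)%E.
Proof. exact: (Lnorm_onD leb mD). Qed.

Lemma Lp_enormZ p c f : 0 < p -> lmeasurable f ->
  (Lp_enorm p (fun x => c * f x)%R = `|c|%:E * Lp_enorm p f)%E.
Proof. exact: (Lnorm_onZ leb mD). Qed.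

Lemma Lp_enorm_sum p (I : Type) (r : seq I) (F : I -> R -> R) : 1 <= p ->
  (forall i, lmeasurable (F i)) ->
  (Lp_enorm p (fun x => \sum_(i <- r) F i x)%R <= \sum_(i <- r) Lp_enorm p (F i))%E.
Proof. exact: (Lnorm_on_sum leb mD). Qed.

Lemma Lp_enorm_ge0 p f : (0 <= Lp_enorm p f)%E.
Proof. exact: Lnorm_ge0. Qed.

End Lp.

(** * Jensen's inequality and periodic integrands *)

Section Jensen.
Context d (T : measurableType d) (R : realType).
Variables (mu : {measure set T -> \bar R}) (D : set T) (b : R).
Hypothesis mD : measurable D.
Hypothesis muD : mu D = b%:E.
Implicit Types (p : R) (f : T -> R).

(** Hoelder's inequality against the indicator of [D], for the exponent
    conjugate to [p]; no finiteness is assumed, as both sides may be infinite. *)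
Lemma poweR_integral_abs_le p f : 1 <= p -> measurable_fun setT f ->
  ((\int[mu]_(x in D) `|f x|%:E) `^ p <=
   (b `^ (p - 1))%:E * \int[mu]_(x in D) (`|f x| `^ p)%:E)%E.
Proof.
move=> p1 mf; have p0 : 0 < p by exact: lt_le_trans p1.
have b0 : 0 <= b by rewrite -lee_fin -muD measure_ge0.
have I0 q : (0 <= \int[mu]_(x in D) (`|f x| `^ q)%:E)%E.
  by apply: integral_ge0 => x _; rewrite lee_fin powR_ge0.
have [p1'|pn1] := eqVneq p 1.
  rewrite p1' subrr powRr0 mul1e.
  under [in leRHS]eq_integral do rewrite powRr1//.
  by rewrite poweRe1//; apply: integral_ge0 => x _; rewrite lee_fin.
have {pn1}p1' : 1 < p by rewrite lt_neqAle eq_sym pn1.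
(* The exponent conjugate to [p], hence the separate treatment of [p = 1]. *)
pose q := p / (p - 1).
have q0 : 0 < q by rewrite divr_gt0// subr_gt0.
have pq : p^-1 + q^-1 = 1.
  by rewrite /q invf_div; field; rewrite gt_eqF.
have := @hoelder _ _ _ mu (f \* \1_D) \1_D p q (measurable_cut mD mf)
  (measurable_indic mD) p0 q0 pq.
rewrite (Lnorm_onE mu D f p0).
have -> : Lnorm mu 1%:E (EFin \o ((f \* \1_D) \* \1_D)) = (\int[mu]_(x in D) `|f x|%:E)%E.
  rewrite Lnorm1 [RHS]integral_mkcond; apply: eq_integral => x _ /=.
  rewrite patchE indicE; case: ifPn => _; first by rewrite !mulr1.
  by rewrite !mulr0 normr0.
have -> : Lnorm mu q%:E (EFin \o \1_D) = (b `^ q^-1)%:E.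
  rewrite unlock -poweR_EFin -muD -(setIT D) -integral_indic//.
  apply: (congr1 (fun y => y `^ q^-1)%E); rewrite setIT; apply: eq_integral => x _ /=.
  rewrite indicE; case: (x \in D); rewrite ?normr1 ?powR1// normr0 powR0// gt_eqF//.
move=> H.
have H0 : (0 <= \int[mu]_(x in D) `|f x|%:E)%E.
  by apply: integral_ge0 => x _; rewrite lee_fin.
apply: le_trans (gt0_ler_poweR (ltW p0) _ _ H) _.
- by rewrite in_itv/= H0 leey.
- by rewrite in_itv/= leey andbT mule_ge0// ?poweR_ge0// lee_fin powR_ge0.
rewrite poweRM ?poweR_ge0 ?lee_fin ?powR_ge0//.
rewrite -poweRrM mulVf ?gt_eqF// poweRe1// poweR_EFin -powRrM muleC.
rewrite (_ : q^-1 * p = p - 1)//.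
by rewrite /q invf_div; field; rewrite gt_eqF.
Qed.

Lemma powR_Rintegral_le p f : 1 <= p -> measurable_fun setT f ->
  ((`|\int[mu]_(x in D) f x| `^ p)%:E <=
   (b `^ (p - 1))%:E * \int[mu]_(x in D) (`|f x| `^ p)%:E)%E.
Proof.
move=> p1 mf; have p0 : 0 < p by exact: lt_le_trans p1.
apply: le_trans (poweR_integral_abs_le p1 mf).
rewrite -poweR_EFin; apply: gt0_ler_poweR; first exact: ltW.
- by rewrite in_itv/= lee_fin leey andbT.
- by rewrite in_itv/= leey andbT; apply: integral_ge0 => x _; rewrite lee_fin.
apply: le_trans (@le_abse_integral _ _ _ mu D (EFin \o f) mD _); last first.
  by apply/measurable_EFinP; exact: measurable_funTS.
rewrite /Rintegral; case: (integral _ _ _) => [r| |] //=; by rewrite normr0 leey.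
Qed.
End Jensen.

Section period.
Context {R : realType}.
Implicit Types (p c : R) (f : R -> R) (w : R -> \bar R).
Local Notation mu := (@lebesgue_measure R).

Lemma ge0_integral_itvco_split w (a b c : R) : measurable_fun setT w ->
  (forall x, 0 <= w x)%E -> a <= b -> b <= c ->
  (\int[mu]_(x in `[a, c[) w x =
   \int[mu]_(x in `[a, b[) w x + \int[mu]_(x in `[b, c[) w x)%E.
Proof.
move=> mw w0 ab bc.
rewrite (@itv_bndbnd_setU _ _ _ (BLeft b)) ?bnd_simp// ge0_integral_setU//.
  exact: measurable_funTS.
by rewrite disj_set2E; apply/eqP/seteqP; split => x //= []; rewrite !in_itv/= => /andP[_ h1] /andP[h2 _]; lra.
Qed.

Lemma ge0_integral_itvco_shift w (a b c : R) : measurable_fun setT w ->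
  (forall x, 0 <= w x)%E ->
  (\int[mu]_(x in `[a, b[) w (x + c)%R = \int[mu]_(x in `[(a + c)%R, (b + c)%R[) w x)%E.
Proof.
move=> mw w0.
have := @ge0_integral_affine R 1 c `[a + c, b + c[ w (oner_neq0 _) _ mw w0.
rewrite normr1 invr1 mul1e => <- //.
rewrite (_ : _ @^-1` _ = `[a, b[%classic).
  by apply: eq_integral => x _; rewrite mul1r.
by apply/seteqP; split => x /=; rewrite !in_itv/= mul1r lerD2r ltrD2r.
Qed.

(** With [k] the floor of [c], the part of the interval beyond [k + 1] is moved
    back by 1, which gives the period starting at the integer [k]. *)
Lemma ge0_integral_period w c : measurable_fun setT w ->
  (forall x, 0 <= w x)%E -> (forall x, w (x + 1)%R = w x) ->
  (\int[mu]_(x in `[c, (c + 1)%R[) w x = \int[mu]_(x in `[0%R, 1%R[) w x)%E.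
Proof.
move=> mw w0 pw.
have pwn (n : nat) x : w (x + n%:R) = w x by elim: n => [|n IH]; rewrite ?addr0// -natr1 addrA pw.
have pwz (z : int) x : w (x + z%:~R) = w x.
  case: z => n; first exact: pwn.
  by rewrite NegzE rmorphN/= -[LHS](pwn n.+1) subrK.
pose k := (Num.floor c)%:~R : R.
have kc : k <= c by exact: ge_floor.
have ck : c < k + 1 by rewrite /k -[1]/(1%:~R) -rmorphD/=; exact: floorD1_gt.
rewrite (ge0_integral_itvco_split mw w0 (ltW ck)) ?lerD2r//.
rewrite -(ge0_integral_itvco_shift k c 1 mw w0).
under [X in (_ + X)%E]eq_integral do rewrite pw.
rewrite addeC -(ge0_integral_itvco_split mw w0 kc (ltW ck)).
rewrite (_ : `[k, k + 1[%classic = `[0 + k, 1 + k[%classic); last by rewrite add0r addrC.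
rewrite -(ge0_integral_itvco_shift 0 1 k mw w0).
by apply: eq_integral => x _; rewrite pwz.
Qed.

Lemma ge0_integral_period_shift w c : measurable_fun setT w ->
  (forall x, 0 <= w x)%E -> (forall x, w (x + 1)%R = w x) ->
  (\int[mu]_(x in `[0%R, 1%R[) w (x + c)%R = \int[mu]_(x in `[0%R, 1%R[) w x)%E.
Proof.
move=> mw w0 pw.
by rewrite ge0_integral_itvco_shift// add0r addrC ge0_integral_period.
Qed.

Lemma Lp_enorm_shift p f c : 0 < p -> measurable_fun setT f -> periodic f 1 ->
  Lp_enorm p (fun x => f (x + c)) = Lp_enorm p f.
Proof.
move=> p0 mf pf.
have mfc : measurable_fun setT (fun x : R => f (x + c)).
  by apply: measurableT_comp => //; exact: measurable_funD.
rewrite (Lp_enormE p0 mf) (Lp_enormE p0 mfc).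
apply: (congr1 (fun y => y `^ p^-1)%E).
apply: (@ge0_integral_period_shift (fun x => (`|f x| `^ p)%:E)).
- exact: measurable_powR_norm.
- by move=> x; rewrite lee_fin powR_ge0.
- by move=> x; rewrite pf.
Qed.
End period.

(** * The norm of an average of functions *)

Section avg_bound.
Context {R : realType}.
Implicit Types (p : R).
Local Notation mu := (@lebesgue_measure R).

(** Jensen's inequality in the variable [t], for each [x], and then Tonelli's
    theorem: this is the integral form of Minkowski's inequality for a uniform
    bound [M]. *)
Lemma Lp_enorm_integral_le p (Phi : R * R -> R) (M : \bar R) :
  1 <= p -> measurable_fun setT Phi ->
  (forall t, 0 <= t <= 1 -> (Lp_enorm p (fun x => Phi (x, t)) <= M)%E) ->
  measurable_fun setT (fun x => \int[mu]_(t in `[0, 1]) Phi (x, t)) ->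
  (Lp_enorm p (fun x => \int[mu]_(t in `[0, 1]) Phi (x, t))%R <= M)%E.
Proof.
move=> p1 mPhi PhiM mI; have p0 : 0 < p by exact: lt_le_trans p1.
have pn0 : p != 0 by rewrite gt_eqF.
have M0 : (0 <= M)%E.
  by apply: le_trans (PhiM 0 _); rewrite ?Lp_enorm_ge0// lexx ler01.
have m1 x : measurable_fun setT (fun t => Phi (x, t)) by exact: measurableT_comp.
have m2 t : measurable_fun setT (fun x => Phi (x, t)) by exact: measurableT_comp.
have mu01 : mu `[0%R, 1%R] = 1%:E by rewrite lebesgue_measure_itv/= lte_fin ltr01 sube0.
have I01 : measurable (`[0, 1[%classic : set R) by [].
have J01 : measurable (`[0, 1]%classic : set R) by [].
(* Both domains are encoded by indicators, Tonelli's theorem being used on the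
   whole plane. *)
pose F (z : R * R) := (`|Phi z| `^ p * \1_(`[0, 1[) z.1 * \1_(`[0, 1]) z.2)%:E.
have mF : measurable_fun setT F.
  apply/measurable_EFinP; apply: measurable_funM; last first.
    by apply: measurableT_comp => //; exact: measurable_indic.
  apply: measurable_funM; last first.
    by apply: measurableT_comp => //; exact: measurable_indic.
  by apply/measurable_EFinP; exact: measurable_powR_norm.
have F0 z : (0 <= F z)%E by rewrite lee_fin !mulr_ge0// powR_ge0.
rewrite (Lp_enormE p0 mI).
have -> : M = ((M `^ p) `^ p^-1)%E by rewrite -poweRrM mulfV// poweRe1.
apply: gt0_ler_poweR; first by rewrite invr_ge0 ltW.
- rewrite in_itv/= leey andbT; apply: integral_ge0 => x _; rewrite lee_fin; exact: powR_ge0.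
- by rewrite in_itv/= leey andbT poweR_ge0.
apply: (@le_trans _ _ (\int[mu]_x \int[mu]_t F (x, t))%E).
  rewrite [leLHS]integral_mkcond; apply: ge0_le_integral => //.
  - move=> x _; rewrite patchE; case: ifPn => // _; by rewrite lee_fin powR_ge0.
  - apply: (iffLR (measurable_restrictT _ I01)).
    by apply: measurable_funTS; exact: measurable_powR_norm.
  - exact: measurable_fun_fubini_tonelli_F.
  move=> x _; rewrite patchE; case: ifPn => xI; last exact: integral_ge0.
  have HJ := @powR_Rintegral_le _ _ _ mu _ 1 J01 mu01 p _ p1 (m1 x).
  apply: (le_trans HJ).
  rewrite powR1 mul1e [leLHS]integral_mkcond.
  rewrite (_ : (_ \_ _) = (fun t => F (x, t)))//; apply/funext => t.
  rewrite patchE /F /= !indicE xI mulr1.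
  by case: ifPn => _; rewrite ?mulr1 ?mulr0.
rewrite (@fubini_tonelli _ _ _ _ _ mu mu _ mF F0).
apply: (@le_trans _ _ (\int[mu]_(t in `[0%R, 1%R]) (M `^ p))%E); last first.
  by rewrite integral_cst// [X in (_ * X)%E]mu01 mule1.
rewrite [leRHS]integral_mkcond; apply: ge0_le_integral => //.
- by move=> x _; exact: integral_ge0.
- exact: measurable_fun_fubini_tonelli_G.
- by apply: (iffLR (measurable_restrictT _ J01)); exact: measurable_cst.
move=> t _; rewrite patchE; case: ifPn => tJ; last first.
  rewrite le_eqVlt; apply/orP; left; apply/eqP.
  rewrite -[RHS](integral0 mu setT); apply: eq_integral => x _.
  by rewrite /F/= !indicE (negbTE tJ) mulr0.
have : (Lp_enorm p (fun x => Phi (x, t)) <= M)%E.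
  by apply: PhiM; move: tJ; rewrite inE/= in_itv.
rewrite (Lp_enormE p0 (m2 t)) => H.
have I0 : (0 <= \int[mu]_(x in `[0%R, 1%R[) (`|Phi (x, t)| `^ p)%:E)%E.
  by apply: integral_ge0 => x _; rewrite lee_fin powR_ge0.
have -> : (\int[mu]_x F (x, t) = \int[mu]_(x in `[0%R, 1%R[) (`|Phi (x, t)| `^ p)%:E)%E.
  rewrite [RHS]integral_mkcond; apply: eq_integral => x _.
  rewrite patchE /F/= !indicE tJ mulr1; by case: ifPn => _; rewrite ?mulr1 ?mulr0.
move: I0 H; set I := integral _ _ _ => I0 H.
have -> : I = ((I `^ p^-1) `^ p)%E by rewrite -poweRrM mulVf// poweRe1.
apply: gt0_ler_poweR; first exact: ltW.
- by rewrite in_itv/= leey poweR_ge0.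
- by rewrite in_itv/= leey M0.
- exact: H.
Qed.
End avg_bound.

(** * Functions integrable on bounded intervals *)

Section interval_integrable.
Context {R : realType}.
Implicit Types (a b c d p : R) (f g : R -> R).
Local Notation mu := (@lebesgue_measure R).

(** Measurability is part of the notion, so that it is stable under the
    operations below without side conditions. *)
Definition interval_integrable f :=
  measurable_fun setT f /\ forall a b, (\int[mu]_(x in `[a, b]) `|f x|%:E < +oo)%E.

Lemma interval_integrableP f a b : interval_integrable f ->
  mu.-integrable `[a, b] (EFin \o f).
Proof.
move=> [mf fi]; apply/integrableP; split; last exact: fi.
by apply/measurable_EFinP; exact: measurable_funTS.
Qed.

Lemma continuous_interval_integrable f : continuous f -> interval_integrable f.
Proof.
move=> cf; split; first exact: continuous_measurable_fun.
move=> a b; have : mu.-integrable `[a, b] (EFin \o f).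
  apply: continuous_compact_integrable; first exact: segment_compact.
  exact: continuous_subspaceT.
by case/integrableP.
Qed.

Lemma interval_integrableD f g : interval_integrable f -> interval_integrable g ->
  interval_integrable (fun x => f x + g x).
Proof.
move=> fi gi; split; first by apply: measurable_funD; [case: fi|case: gi].
move=> a b; have : mu.-integrable `[a, b] ((EFin \o f) \+ (EFin \o g))%E.
  by apply: integrableD => //; exact: interval_integrableP.
by case/integrableP.
Qed.

Lemma interval_integrableZ c f : interval_integrable f ->
  interval_integrable (fun x => c * f x).
Proof.
move=> fi; split; first by apply: measurable_funM => //; case: fi.
move=> a b; have : mu.-integrable `[a, b] (fun x => c%:E * (EFin \o f) x)%E.
  by apply: integrableZl => //; exact: interval_integrableP.
by case/integrableP.
Qed.

Lemma interval_integrable_sum (I : Type) (r : seq I) (F : I -> R -> R) :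
  (forall i, interval_integrable (F i)) ->
  interval_integrable (fun x => \sum_(i <- r) F i x).
Proof.
move=> Fi; elim: r => [|i r IH].
  rewrite (_ : (fun=> _) = (fun=> 0)); last by apply/funext => x; rewrite big_nil.
  by apply: continuous_interval_integrable => x; exact: cvg_cst.
rewrite (_ : (fun=> _) = (fun x => F i x + \sum_(j <- r) F j x)).
  exact: interval_integrableD.
by apply/funext => x; rewrite big_cons.
Qed.

Lemma interval_integrable_affine c d f : interval_integrable f ->
  interval_integrable (fun t => f (c * t + d)).
Proof.
move=> [mf fi]; have [->|c0] := eqVneq c 0.
  apply: continuous_interval_integrable => x.
  rewrite (_ : (fun t => _) = (fun=> f d)); first exact: cvg_cst.
  by apply/funext => t; rewrite mul0r add0r.
split; first by apply: measurableT_comp => //; exact: measurable_affine.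
move=> a b; pose M := `|c| * (`|a| + `|b|).
have mfa : measurable_fun setT (fun x => `|f x|%:E).
  by apply/measurable_EFinP; exact: measurableT_comp.
have := @ge0_integral_affine R c d `[d - M, d + M] (fun x => `|f x|%:E) c0.
move=> /(_ _ mfa) H.
have mP : measurable ((fun x : R => c * x + d) @^-1` `[d - M, d + M]).
  by rewrite -[X in measurable X]setTI; apply: measurable_affine.
apply: le_lt_trans (_ : (_ <= \int[mu]_(x in (fun x : R => c * x + d)%R @^-1` `[(d - M)%R, (d + M)%R])
    `|f (c * x + d)%R|%:E)%E) _.
  apply: ge0_subset_integral => //.
    apply: measurable_funTS; apply: (measurableT_comp mfa).
    exact: measurable_affine.
  move=> t /=; rewrite !in_itv/= => /andP[at_ tb].
  have : `|c * t| <= M.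
    rewrite normrM ler_wpM2l//.
    have := ler_norm b; have := ler_norm (- a); rewrite normrN => h1 h2.
    have := normr_ge0 a; have := normr_ge0 b => h3 h4.
    rewrite ler_norml; apply/andP; split; lra.
  by rewrite ler_norml => /andP[? ?]; apply/andP; split; lra.
rewrite H//.
by apply: lte_mul_pinfty => //; rewrite lee_fin invr_ge0.
Qed.

(** Positive and negative parts are transformed separately; integrability is
    needed to recombine them. *)
Lemma Rintegral_affine c d f u v : c != 0 -> interval_integrable f ->
  \int[mu]_(t in (fun t : R => c * t + d) @^-1` `[u, v]) f (c * t + d) =
  `|c|^-1 * \int[mu]_(t in `[u, v]) f t.
Proof.
move=> c0 fi; have [mf _] := fi.
have intf := interval_integrableP u v fi.
rewrite /Rintegral -[`|c|^-1]/(fine (`|c|^-1)%:E) -fineM//; last exact: integrable_fin_num.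
apply: (congr1 fine); rewrite integralE [in RHS]integralE muleBr//; last first.
  rewrite fin_num_adde_defl// fin_numN; exact: integrable_neg_fin_num.
have mE : measurable_fun setT (EFin \o f) by exact/measurable_EFinP.
have mp := measurable_funepos mE; have mn := measurable_funeneg mE.
rewrite -(@ge0_integral_affine R c d `[u, v] _ c0 _ mp); [|by []|by move=> x; exact: funepos_ge0].
rewrite -(@ge0_integral_affine R c d `[u, v] _ c0 _ mn); [|by []|by move=> x; exact: funeneg_ge0].
by congr (_ - _)%E; apply: eq_integral => x _; rewrite ?funeposE ?funenegE.
Qed.

(** By Jensen's inequality [|f|] is integrable over one period, and a bounded
    interval is covered by finitely many periods. *)
Lemma Lp_interval_integrable p f : 1 <= p -> measurable_fun setT f ->
  periodic f 1 -> (Lp_enorm p f < +oo)%E -> interval_integrable f.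
Proof.
move=> p1 mf pf; have p0 : 0 < p by exact: lt_le_trans p1.
rewrite (Lp_enormE p0 mf) => /lty_poweRy; rewrite invr_eq0 gt_eqF// => /(_ isT) H.
have mfa : measurable_fun setT (fun x => `|f x|%:E).
  by apply/measurable_EFinP; exact: measurableT_comp.
have mI : measurable (`[0, 1[%classic : set R) by [].
have muI : mu `[0%R, 1%R[%classic = (1:R)%:E.
  by rewrite lebesgue_measure_itv/= lte_fin ltr01 sube0.
have := @poweR_integral_abs_le _ _ _ mu _ 1 mI muI p f p1 mf.
rewrite powR1 mul1e => /le_lt_trans/(_ H)/lty_poweRy.
rewrite gt_eqF// => /(_ isT) I1.
(* Over [k] consecutive periods the integral is [k] times the one over a period. *)
have Ik a (k : nat) : (\int[mu]_(x in `[a, (a + k%:R)%R[) `|f x|%:E < +oo)%E.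
  elim: k => [|k IH]; first by rewrite addr0 set_itvco0 integral_set0.
  rewrite (@ge0_integral_itvco_split R (fun x => `|f x|%:E) a (a + k%:R))//; last 2 first.
  - by rewrite lerDl.
  - by rewrite lerD2l ler_nat.
  rewrite lte_add_pinfty// -natr1 addrA ge0_integral_period//.
  by move=> x; rewrite pf.
split => // a b; pose k := (Num.truncn (b - a)).+1.
apply: le_lt_trans (Ik a k); apply: ge0_subset_integral => //.
  exact: measurable_funTS.
move=> x /=; rewrite !in_itv/= => /andP[-> xb]/=.
by rewrite (le_lt_trans xb)// -ltrBlDl truncnS_gt.
Qed.
End interval_integrable.

(** * Averages over an interval *)

Section average.
Context {R : realType}.
Implicit Types (a b c d p x : R) (f g : R -> R).
Local Notation mu := (@lebesgue_measure R).

(** The mean of [f] over [x, x + a], written over [0, 1] so that [average 0]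
    is the identity and needs no separate treatment in the identities below. *)
Definition average a f : R -> R := fun x => \int[mu]_(t in `[0, 1]) f (a * t + x).

Lemma average0 f : average 0 f = f.
Proof.
apply/funext => x; rewrite /average; under eq_Rintegral do rewrite mul0r add0r.
rewrite Rintegral_cst// (_ : fine _ = 1) ?mulr1//.
by rewrite [X in fine X]lebesgue_measure_itv/= lte_fin ltr01 sube0.
Qed.

Lemma average_periodic a f : periodic f 1 -> periodic (average a f) 1.
Proof. by move=> pf x; rewrite /average; under eq_Rintegral do rewrite addrA pf. Qed.

Lemma averageE a f x : 0 < a -> interval_integrable f ->
  average a f x = a^-1 * \int[mu]_(t in `[x, x + a]) f t.
Proof.
move=> a0 fi; have := @Rintegral_affine R a x f x (x + a) (lt0r_neq0 a0) fi.
rewrite gtr0_norm// => <-; rewrite /average.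
rewrite (_ : _ @^-1` _ = `[0, 1]%classic)//; apply/seteqP; split => t /=; rewrite !in_itv/=.
  move=> /andP[h1 h2]; have : 0 <= a * t <= a * 1 by apply/andP; split; lra.
  by rewrite pmulr_rge0// ler_pM2l.
move=> /andP[h1 h2]; have : 0 <= a * t <= a * 1 by rewrite pmulr_rge0// ler_pM2l// h1.
by move=> /andP[? ?]; apply/andP; split; lra.
Qed.

(** A base point [c] on the left of [x] expresses the average through one
    primitive, to which the continuity and differentiability theorems apply. *)
Lemma average_primitive a f c x : 0 < a -> c < x -> interval_integrable f ->
  average a f x = a^-1 * (\int[mu]_(t in `[c, x + a]) f t - \int[mu]_(t in `[c, x]) f t).
Proof.
move=> a0 cx fi; rewrite averageE// Rintegral_itvB; last 3 first.
- exact: interval_integrableP.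
- by rewrite bnd_simp ltW.
- by rewrite bnd_simp lerDl ltW.
rewrite Rintegral_itv_obnd_cbnd//.
apply: (@integrableS _ _ _ mu `[x, x + a]) => //.
  exact: subset_itv_oc_cc.
exact: interval_integrableP.
Qed.

Lemma primitive_continuous f c x : c < x -> interval_integrable f ->
  {for x, continuous (fun y => \int[mu]_(t in `[c, y]) f t)}.
Proof.
move=> cx fi.
have cx1 : c < x + 1 by lra.
apply: (within_continuous_continuous cx1).
  by apply: parameterized_integral_continuous; [exact: ltW|exact: interval_integrableP].
by rewrite in_itv/= cx/= ltrDl.
Qed.

Lemma average_continuous a f : 0 < a -> interval_integrable f -> continuous (average a f).
Proof.
move=> a0 fi x.
pose P := fun y => \int[mu]_(t in `[x - 1, y]) f t.
have near_eq : \forall y \near x, a^-1 * (P (y + a) - P y) = average a f y.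
  near=> y; rewrite (@average_primitive a f (x - 1))//.
  by near: y; apply: lt_nbhsr; lra.
suff : {for x, continuous (fun y => a^-1 * (P (y + a) - P y))}.
  move=> H; rewrite /continuous_at -(nbhs_singleton near_eq).
  by apply: cvg_trans H; apply: near_eq_cvg.
apply: cvgM; first exact: cvg_cst.
apply: cvgB; last by apply: primitive_continuous => //; lra.
apply: (@continuous_comp _ _ _ (fun y => y + a) P).
  by apply: cvgD; [exact: cvg_id|exact: cvg_cst].
by apply: primitive_continuous => //; lra.
Unshelve. all: by end_near. Qed.

(** The derivative exists at every point because [f] is continuous. *)
Lemma average_is_derive a f x : 0 < a -> continuous f ->
  is_derive x 1 (average a f) (a^-1 * (f (x + a) - f x)).
Proof.
move=> a0 cf; have fi := continuous_interval_integrable cf.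
pose P := fun y => \int[mu]_(t in `[x - 1, y]) f t.
have near_eq : \forall y \near x, a^-1 * (P (y + a) - P y) = average a f y.
  near=> y; rewrite (@average_primitive a f (x - 1))//.
  by near: y; apply: lt_nbhsr; lra.
have dP y : x - 1 < y -> is_derive y 1 P (f y).
  move=> xy; have y1 : y < y + 1 by lra.
  have [dPy PE] := @continuous_FTC1_closed R f (x - 1) y (y + 1) y1
     (interval_integrableP _ _ fi) xy (cf y).
  by apply: DeriveDef; [exact: dPy|rewrite -derive1E; exact: PE].
apply: (near_eq_is_derive near_eq).
have d1 : is_derive x 1 P (f x) by apply: dP; lra.
have d2 : is_derive x 1 (fun y => P (y + a)) (f (x + a)).
  have d2 : is_derive (x + a) 1 P (f (x + a)) by apply: dP; lra.
  have d3 : is_derive x 1 (fun y : R => y + a) 1 by exact: is_derive_shift.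
  by have := @is_derive1_comp R P (fun y => y + a) x _ _ d2 d3; rewrite mulr1.
exact: (@is_deriveZ _ _ _ _ a^-1 x 1 _ (is_deriveB d2 d1)).
Unshelve. all: by end_near. Qed.
End average.

(** * Finite differences and their averages *)

Section finite_differences.
Context {R : realType}.
Implicit Types (a b c d p x h : R) (f g : R -> R) (s : nat).
Local Notation mu := (@lebesgue_measure R).

Lemma finite_diff0 h f : finite_diff 0 h f = f.
Proof.
by apply/funext => x; rewrite /finite_diff big_ord1 bin0 expr0 !mul1r mul0r addr0.
Qed.

(** Pascal's rule: the difference of order [s + 1] is the first difference of
    the difference of order [s]. *)
Lemma finite_diffS s h f x :
  finite_diff s.+1 h f x = finite_diff s h f (x + h) - finite_diff s h f x.
Proof.
rewrite /finite_diff big_ord_recl /=.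
under eq_bigr => i _ do rewrite /bump leq0n add1n binS natrD 2!mulrDl subSS exprS mulN1r.
rewrite big_split/= addrA; congr (_ + _); last first.
  rewrite -sumrN; apply: eq_bigr => i _.
  by rewrite mulrN mulNr.
rewrite big_ord_recr/= (bin_small (ltnSn s)) mulr0n !mul0r addr0 [in RHS]big_ord_recl/=; congr (_ + _).
  by rewrite !bin0 !subn0; congr (_ * f _); rewrite -(natr1 s); ring.
apply: eq_bigr => i _; rewrite /bump leq0n add1n exprS mulN1r; congr (_ * f _).
have -> : (s - i = (s - i.+1).+1)%N by rewrite subnSK.
by rewrite -(natr1 (s - i.+1)); ring.
Qed.

Lemma finite_diff_h0 s f : (0 < s)%N -> finite_diff s 0 f = fun=> 0.
Proof. by case: s => // s _; apply/funext => x; rewrite finite_diffS addr0 subrr. Qed.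

Lemma finite_diff_periodic s h f : periodic f 1 -> periodic (finite_diff s h f) 1.
Proof.
move=> pf x; rewrite /finite_diff; apply: eq_bigr => i _; congr (_ * _).
by rewrite addrAC pf.
Qed.

Lemma measurable_finite_diff s h f : measurable_fun setT f ->
  measurable_fun setT (finite_diff s h f).
Proof.
move=> mf; apply: measurable_sum => i; apply: measurable_funM => //.
by apply: measurableT_comp => //; exact: measurable_funD.
Qed.

Lemma Rintegral_sum a b (I : Type) (r : seq I) (F : I -> R -> R) :
  (forall i, interval_integrable (F i)) ->
  \int[mu]_(t in `[a, b]) (\sum_(i <- r) F i t) =
  \sum_(i <- r) \int[mu]_(t in `[a, b]) F i t.
Proof.
move=> Fi; elim: r => [|i r IH].
  rewrite big_nil; under eq_Rintegral do rewrite big_nil.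
  by rewrite Rintegral_cst// mul0r.
rewrite big_cons -IH -RintegralD//.
- by under eq_Rintegral do rewrite big_cons.
- exact: interval_integrableP.
- by apply: interval_integrableP; exact: interval_integrable_sum.
Qed.

Lemma average_finite_diff s h a f : interval_integrable f ->
  average a (finite_diff s h f) = finite_diff s h (average a f).
Proof.
move=> fi; apply/funext => x.
have fic d : interval_integrable (fun t => f (a * t + d)) by exact: interval_integrable_affine.
rewrite /average /finite_diff Rintegral_sum; last first.
  move=> i; apply: interval_integrableZ.
  by under eq_fun do rewrite -addrA; exact: fic.
apply: eq_bigr => i _; rewrite RintegralZl//; last first.
  apply: interval_integrableP.
  by under eq_fun do rewrite -addrA; exact: fic.
by congr (_ * _); under [in LHS]eq_Rintegral do rewrite -addrA.
Qed.

Lemma finite_diff_is_derive s h f g : (forall x, is_derive x 1 f (g x)) ->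
  forall x, is_derive x 1 (finite_diff s h f) (finite_diff s h g x).
Proof.
elim: s => [|s IH] fg x; first by rewrite !finite_diff0.
rewrite finite_diffS.
rewrite (_ : finite_diff s.+1 h f = (finite_diff s h f \o (fun y => y + h)) - finite_diff s h f); last first.
  by apply/funext => y; rewrite finite_diffS.
apply: is_deriveB.
have d3 : is_derive x 1 (fun y : R => y + h) 1 by exact: is_derive_shift.
have := @is_derive1_comp R (finite_diff s h f) (fun y => y + h) x _ _ (IH fg (x + h)) d3.
by rewrite mulr1.
Qed.

Lemma finite_diff_continuous s h f : continuous f -> continuous (finite_diff s h f).
Proof.
move=> cf; elim: s => [|s IH]; first by rewrite finite_diff0.
rewrite (_ : finite_diff s.+1 h f = (fun x => finite_diff s h f (x + h) - finite_diff s h f x)); last first.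
  by apply/funext => y; rewrite finite_diffS.
move=> x; apply: cvgB; last exact: IH.
apply: (@continuous_comp _ _ _ (fun y => y + h) (finite_diff s h f)); last exact: IH.
by apply: cvgD; [exact: cvg_id|exact: cvg_cst].
Qed.

Definition borel_Lp p f := [/\ measurable_fun setT f, periodic f 1 & (Lp_enorm p f < +oo)%E].

Lemma borel_Lp_interval_integrable p f : 1 <= p -> borel_Lp p f -> interval_integrable f.
Proof. by move=> p1 [mf pf fp]; exact: (Lp_interval_integrable p1). Qed.

Lemma Lp_enormB_le p f g : 1 <= p -> measurable_fun setT f -> measurable_fun setT g ->
  (Lp_enorm p (fun x => f x - g x)%R <= Lp_enorm p f + Lp_enorm p g)%E.
Proof.
move=> p1 mf mg; have p0 : 0 < p by exact: lt_le_trans p1.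
have -> : Lp_enorm p g = Lp_enorm p (fun x => -1 * g x)%R.
  by rewrite Lp_enormZ ?normrN1 ?mul1e//; exact: borel_lmeasurable.
rewrite (_ : (fun x => f x - g x)%R = f \+ (fun x => -1 * g x)); last first.
  by apply/funext => x /=; rewrite mulN1r.
apply: (Lp_enormD p1); apply: borel_lmeasurable; first exact: mf.
by apply: measurable_funM; [exact: measurable_cst|exact: mg].
Qed.

Lemma Lp_enorm_finite_diffS p s h f : 1 <= p -> measurable_fun setT f -> periodic f 1 ->
  (Lp_enorm p (finite_diff s.+1 h f) <= 2%:E * Lp_enorm p (finite_diff s h f))%E.
Proof.
move=> p1 mf pf; have p0 : 0 < p by exact: lt_le_trans p1.
have md := measurable_finite_diff s h mf.
rewrite (_ : finite_diff s.+1 h f = (fun x => finite_diff s h f (x + h) - finite_diff s h f x)); last first.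
  by apply/funext => y; rewrite finite_diffS.
apply: le_trans (Lp_enormB_le p1 _ md) _.
  by apply: measurableT_comp => //; exact: measurable_funD.
rewrite Lp_enorm_shift//; last exact: finite_diff_periodic.
by rewrite -mule2n mule_natl.
Qed.

Lemma Lp_enorm_finite_diff_le p s h f : 1 <= p -> measurable_fun setT f -> periodic f 1 ->
  (Lp_enorm p (finite_diff s h f) <= (2 ^+ s)%:E * Lp_enorm p f)%E.
Proof.
move=> p1 mf pf; elim: s => [|s IH]; first by rewrite expr0 mul1e finite_diff0.
apply: le_trans (Lp_enorm_finite_diffS _ _ p1 mf pf) _.
by rewrite exprS EFinM -muleA lee_wpmul2l.
Qed.

Lemma average_borel_Lp p a f : 1 <= p -> 0 <= a -> borel_Lp p f ->
  borel_Lp p (average a f) /\ (Lp_enorm p (average a f) <= Lp_enorm p f)%E.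
Proof.
move=> p1 a0 fL; have p0 : 0 < p by exact: lt_le_trans p1.
have fi := borel_Lp_interval_integrable p1 fL; have [mf pf fp] := fL.
have ma : measurable_fun setT (average a f).
  move: a0; rewrite le_eqVlt => /predU1P[<-|a0]; first by rewrite average0.
  by apply: continuous_measurable_fun; exact: average_continuous.
have H : (Lp_enorm p (average a f) <= Lp_enorm p f)%E.
  rewrite (_ : average a f = fun x => \int[mu]_(t in `[0, 1]) f (a * (x, t).2 + (x, t).1))//.
  apply: (@Lp_enorm_integral_le R p (fun z => f (a * z.2 + z.1))) => //.
    apply: measurableT_comp => //; apply: measurable_funD => //.
    exact: measurable_funM.
  move=> t _ /=; under eq_fun do rewrite addrC.
  by rewrite Lp_enorm_shift.
split => //; split => //; first exact: average_periodic.
exact: le_lt_trans fp.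
Qed.

Lemma iter_average_borel_Lp p a f k : 1 <= p -> 0 <= a -> borel_Lp p f ->
  borel_Lp p (iter k (average a) f).
Proof.
move=> p1 a0 fL; elim: k => [//|k IH]; exact: (average_borel_Lp p1 a0 IH).1.
Qed.

(** The bound is transferred through one averaging at a time: an average of
    [f (x + a_i u)] with step [a_i] is the integral over [t] in [0, 1] of
    [f (x + a_i (u + t))], with the same [t] for all [i]. Each averaging thus
    shortens by 1 the range of [u] on which the bound holds. *)
Lemma Lp_enorm_iter_average_le p f n (c a : 'I_n -> R) (m k : nat) (M : \bar R) :
  1 <= p -> borel_Lp p f -> (forall i, 0 <= a i) ->
  (forall u, 0 <= u <= (m + k)%:R ->
    (Lp_enorm p (fun x => \sum_(i < n) c i * f (x + a i * u))%R <= M)%E) ->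
  (forall u, 0 <= u <= m%:R ->
    (Lp_enorm p (fun x => \sum_(i < n) c i * iter k (average (a i)) f (x + a i * u))%R <= M)%E).
Proof.
move=> p1 fL a0; elim: k m => [|k IH] m H u um; first by apply: H; rewrite addn0.
have {}IH : forall u, 0 <= u <= m.+1%:R ->
    (Lp_enorm p (fun x => \sum_(i < n) c i * iter k (average (a i)) f (x + a i * u))%R <= M)%E.
  by apply: IH => v; rewrite addSnnS; exact: H.
have gL i : borel_Lp p (iter k (average (a i)) f) by exact: iter_average_borel_Lp.
have mg i : measurable_fun setT (iter k (average (a i)) f) by case: (gL i).
pose Phi (z : R * R) := \sum_(i < n) c i * iter k (average (a i)) f (z.1 + a i * (u + z.2)).
have E : (fun x => \sum_(i < n) c i * iter k.+1 (average (a i)) f (x + a i * u)) =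
   (fun x => \int[mu]_(t in `[0, 1]) Phi (x, t)).
  apply/funext => x; rewrite /Phi Rintegral_sum; last first.
    move=> i; apply: interval_integrableZ.
    rewrite (_ : (fun _ => _) = (fun t => iter k (average (a i)) f (a i * t + (x + a i * u)))).
      exact/interval_integrable_affine/(borel_Lp_interval_integrable p1).
    by apply/funext => t /=; congr (iter _ _ _ _); ring.
  apply: eq_bigr => i _; rewrite RintegralZl//; last first.
    apply: interval_integrableP.
    rewrite (_ : (fun _ => _) = (fun t => iter k (average (a i)) f (a i * t + (x + a i * u)))).
      exact/interval_integrable_affine/(borel_Lp_interval_integrable p1).
    by apply/funext => t /=; congr (iter _ _ _ _); ring.
  congr (_ * _) => /=; apply: eq_Rintegral => t _.
  by congr (iter _ _ _ _); ring.
have mE : measurable_fun setT (fun x => \int[mu]_(t in `[0, 1]) Phi (x, t)).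
  rewrite -E; apply: measurable_sum => i; apply: measurable_funM => //.
  apply: measurableT_comp; last exact: measurable_funD.
  by case: (iter_average_borel_Lp k.+1 p1 (a0 i) fL).
rewrite E; apply: Lp_enorm_integral_le => //.
  apply: measurable_sum => i; apply: measurable_funM => //.
  apply: measurableT_comp => //; apply: measurable_funD => //.
  by apply: measurable_funM => //; exact: measurable_funD.
move=> t /andP[t0 t1]; apply: (IH (u + t)).
by move/andP: um => [u0 um]; rewrite -natr1 addr_ge0// lerD.
Qed.

End finite_differences.

(** * A smooth approximation built from averages *)

Section smoothing.
Context {R : realType}.
Implicit Types (a b c d p x h : R) (f g : R -> R) (s m k : nat).
Local Notation mu := (@lebesgue_measure R).

(** For [k = 0] this is the approximation [g] of [f]; for [0 < k < m] it is its
    [k]-th derivative, since every derivative turns one average of step [a] into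
    a difference quotient of step [a]. *)
Definition smoothing m h f k : R -> R := fun x =>
  \sum_(i < m) (- (-1) ^+ (m + i) * 'C(m, i)%:R) *
    (((m - i)%:R * h) ^- k *
     finite_diff k ((m - i)%:R * h) (iter (m - k) (average ((m - i)%:R * h)) f) x).

Lemma continuous_sum (I : Type) (r : seq I) (F : I -> R -> R) :
  (forall i, continuous (F i)) -> continuous (fun x => \sum_(i <- r) F i x).
Proof.
move=> cF; elim: r => [|i r IH] x.
  by under eq_fun do rewrite big_nil; exact: cvg_cst.
by under eq_fun do rewrite big_cons; apply: cvgD; [exact: cF|exact: IH].
Qed.

Lemma iter_average_continuous a f k : 0 < a -> interval_integrable f ->
  continuous (iter k.+1 (average a) f).
Proof.
move=> a0 fi; elim: k => [|k IH]; first exact: average_continuous.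
by apply: average_continuous => //; exact: continuous_interval_integrable.
Qed.

Lemma iter_average_periodic a f k : periodic f 1 -> periodic (iter k (average a) f) 1.
Proof. by move=> pf; elim: k => // k IH; exact: average_periodic. Qed.

Lemma smoothing_step_gt0 m h (i : 'I_m) : 0 < h -> 0 < (m - i)%:R * h.
Proof. by move=> h0; rewrite mulr_gt0// ltr0n subn_gt0. Qed.

(** For [k < m] at least one averaging is left. *)
Lemma smoothing_continuous m h f k : 0 < h -> interval_integrable f -> (k < m)%N ->
  continuous (smoothing m h f k).
Proof.
move=> h0 fi km; apply: continuous_sum => i x.
apply: cvgM; first exact: cvg_cst.
apply: cvgM; first exact: cvg_cst.
apply: finite_diff_continuous; rewrite -(subnSK km).
by apply: iter_average_continuous => //; exact: smoothing_step_gt0.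
Qed.

Lemma smoothing_periodic m h f k : periodic f 1 -> periodic (smoothing m h f k) 1.
Proof.
move=> pf x; apply: eq_bigr => i _; do 2 congr (_ * _).
by apply: finite_diff_periodic; exact: iter_average_periodic.
Qed.

(** At least one averaging must remain after the derivation, for the averaged
    function to be continuous: hence [k + 1 < m]. *)
Lemma smoothing_is_derive m h f k x : 0 < h -> interval_integrable f -> (k.+1 < m)%N ->
  is_derive x 1 (smoothing m h f k) (smoothing m h f k.+1 x).
Proof.
move=> h0 fi km; rewrite /smoothing.
rewrite (_ : (fun y => _) = \sum_(i < m) ((- (-1) ^+ (m + i) * 'C(m, i)%:R) \*:
    (((m - i)%:R * h) ^- k \*:
     finite_diff k ((m - i)%:R * h) (iter (m - k) (average ((m - i)%:R * h)) f)))); last first.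
  by apply/funext => y; rewrite fct_sumE.
apply: is_derive_sum => i; apply: is_deriveZ.
set a := (m - i)%:R * h; have a0 : 0 < a by exact: smoothing_step_gt0.
rewrite -(subnSK (ltnW km)) /=; set u := iter _ _ f.
have cu : continuous u.
  by rewrite /u -(subnSK km); exact: iter_average_continuous.
have -> : a ^- k.+1 * finite_diff k.+1 a u x =
   a ^- k *: finite_diff k a (fun y => a^-1 * (u (y + a) - u y)) x.
  rewrite finite_diffS exprSr invfM -mulrA; congr (_ * _).
  rewrite /finite_diff mulrBr !mulr_sumr -sumrB; apply: eq_bigr => j _.
  rewrite addrAC; ring.
apply: is_deriveZ; apply: finite_diff_is_derive => y.
exact: average_is_derive.
Qed.

Lemma derive1n_smoothing m h f k : 0 < h -> interval_integrable f -> (k < m)%N ->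
  (smoothing m h f 0)^`(k)%classic = smoothing m h f k.
Proof.
move=> h0 fi; elim: k => // k IH km; rewrite derive1nS IH; last exact: ltnW.
apply/funext => x; rewrite derive1E.
by apply: derive_val; exact: smoothing_is_derive.
Qed.

(** The term of index [m] has step 0, so that it is [f] up to sign. The
    summand [_ * 0] in the argument is the parameter [u] of
    [Lp_enorm_iter_average_le], evaluated at 0. *)
Lemma smoothing0_error m h f x :
  f x - smoothing m h f 0 x = (-1) ^+ m *
   \sum_(i < m.+1) ('C(m, i)%:R * (-1) ^+ i) *
      iter m (average ((m - i)%:R * h)) f (x + (m - i)%:R * h * 0).
Proof.
rewrite big_ord_recr/= subnn mul0r mul0r addr0 binn mul1r.
have -> : iter m (average 0) f = f.
  by elim: (X in iter X _ _) => //= n ->; rewrite average0.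
rewrite mulrDr mulrA -expr2 sqrr_sign mul1r addrC; congr (_ + _).
rewrite /smoothing mulr_sumr -sumrN; apply: eq_bigr => i _.
rewrite subn0 expr0 invr1 mul1r finite_diff0 mulr0 addr0 exprD; ring.
Qed.

(** Before averaging, the combination of [smoothing0_error] is the difference
    of [f] of order [m] and step [h u], with [u] in [0, m]. *)
Lemma smoothing_error_le p m h f (M : \bar R) : 1 <= p -> 0 < h -> borel_Lp p f ->
  (forall t, 0 <= t <= m%:R * h -> (Lp_enorm p (finite_diff m t f) <= M)%E) ->
  (Lp_enorm p (fun x => f x - smoothing m h f 0 x)%R <= M)%E.
Proof.
move=> p1 h0 fL HM; have p0 : 0 < p by exact: lt_le_trans p1.
have [mf pf _] := fL.
have a0 (i : 'I_m.+1) : 0 <= (m - i)%:R * h by rewrite mulr_ge0// ltW.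
under eq_fun do rewrite smoothing0_error.
rewrite (Lp_enormZ _ p0); last first.
  apply: borel_lmeasurable; apply: measurable_sum => i; apply: measurable_funM => //.
  apply: measurableT_comp; last exact: measurable_funD.
  by case: (iter_average_borel_Lp m p1 (a0 i) fL).
rewrite normrX normrN1 expr1n mul1e.
apply: (@Lp_enorm_iter_average_le R p f m.+1 (fun i => 'C(m, i)%:R * (-1) ^+ i)
   (fun i => (m - i)%:R * h) 0 m M p1 fL a0); last by rewrite !lexx.
move=> u /andP[u0 um].
have := HM (h * u); rewrite /finite_diff.
under eq_fun do under eq_bigr do rewrite mulrA.
apply; apply/andP; split; first by rewrite mulr_ge0// ltW.
by rewrite mulrC ler_wpM2r// ltW.
Qed.

(** Differences commute with averages and averages do not increase the norm,
    so each term is bounded by a difference of [f] of order [s] divided by the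
    power [s] of its step, which is at least [h]; the binomial coefficients add
    up to at most [2 ^ s.+1]. *)
Lemma Lp_enorm_smoothing_le p s h f (M : R) : 1 <= p -> 0 < h -> borel_Lp p f ->
  (forall t, 0 < t <= s.+1%:R * h -> (Lp_enorm p (finite_diff s t f) <= M%:E)%E) ->
  (Lp_enorm p (smoothing s.+1 h f s) <= (2 ^+ s.+1 * h ^- s * M)%:E)%E.
Proof.
move=> p1 h0 fL HM; have p0 : 0 < p by exact: lt_le_trans p1.
have fi := borel_Lp_interval_integrable p1 fL.
have [mf pf _] := fL.
have M0 : 0 <= M.
  rewrite -lee_fin; apply: le_trans (HM (s.+1%:R * h) _); first exact: Lp_enorm_ge0.
  by rewrite mulr_gt0//= lexx.
pose a (i : 'I_s.+1) := (s.+1 - i)%:R * h.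
have a0 i : 0 < a i by exact: smoothing_step_gt0.
have aM i : 0 < a i <= s.+1%:R * h.
  by rewrite a0 /a ler_wpM2r ?ler_nat ?leq_subr// ltW.
pose G (i : 'I_s.+1) := finite_diff s (a i) (average (a i) f).
have GE i : G i = average (a i) (finite_diff s (a i) f) by rewrite average_finite_diff.
have dL i : borel_Lp p (finite_diff s (a i) f).
  split; [exact: measurable_finite_diff|exact: finite_diff_periodic|].
  apply: (@le_lt_trans _ _ M%:E); last exact: ltry.
  exact: HM.
have mG i : measurable_fun setT (G i).
  by rewrite GE; case: (average_borel_Lp p1 (ltW (a0 i)) (dL i)) => -[].
have GM i : (Lp_enorm p (G i) <= M%:E)%E.
  rewrite GE; apply: le_trans (average_borel_Lp p1 (ltW (a0 i)) (dL i)).2 _.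
  exact: HM.
pose c (i : 'I_s.+1) := (- (-1) ^+ (s.+1 + i) * 'C(s.+1, i)%:R) * (a i) ^- s.
have -> : smoothing s.+1 h f s = fun x => \sum_(i < s.+1) c i * G i x.
  by apply/funext => x; apply: eq_bigr => i _; rewrite subSnn mulrA.
apply: le_trans (Lp_enorm_sum _ p1 _) _.
  by move=> i; apply: borel_lmeasurable; apply: measurable_funM.
apply: (@le_trans _ _ (\sum_(i < s.+1) ('C(s.+1, i)%:R * h ^- s * M)%:E)%E).
  apply: lee_sum => i _; rewrite Lp_enormZ//; last exact: borel_lmeasurable.
  rewrite EFinM; apply: lee_pmul => //; first exact: Lp_enorm_ge0.
  rewrite lee_fin /c !normrM normrN normrX normrN1 expr1n mul1r normr_nat.
  rewrite ler_wpM2l// normfV gtr0_norm ?exprn_gt0// lef_pV2 ?posrE ?exprn_gt0//.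
  apply: lerXn2r; rewrite ?nnegrE; [exact: ltW|exact: ltW|].
  by rewrite /a ler_peMl ?(ltW h0)// ler1n subn_gt0.
rewrite sumEFin lee_fin -!mulr_suml ler_wpM2r// ler_wpM2r ?invr_ge0 ?exprn_ge0 ?(ltW h0)//.
rewrite -[2]/(1 + 1) exprDn [leRHS]big_ord_recr/= ler_wpDr ?expr1n ?mulr1//.
by apply: ler_sum => i _; rewrite !expr1n mulr1.
Qed.

End smoothing.

(** * Pointwise bounds on finite differences *)

Section pointwise.
Context {R : realType}.
Implicit Types (a b c d p x y z h : R) (f g : R -> R) (s m k : nat).
Local Notation mu := (@lebesgue_measure R).

Lemma is_derive_continuous f g : (forall x, is_derive x 1 f (g x)) -> continuous f.
Proof.
move=> fg x; apply/differentiable_continuous; rewrite -derivable1_diffP.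
by have [] := fg x.
Qed.

(** The derivative is bounded on the compact interval, so [f] is Lipschitz. *)
Lemma is_derive_absolutely_continuous f g a b : a <= b ->
  (forall x, is_derive x 1 f (g x)) -> continuous g ->
  Defs.absolutely_continuous a b f.
Proof.
move=> ab fg cg.
have cng : {within `[a, b], continuous (fun x => `|g x|)}.
  apply: continuous_subspaceT => x; apply: (@continuous_comp _ _ _ g Num.norm); first exact: cg.
  exact: norm_continuous.
have [K0 _ HK] := EVT_max ab cng; set K := `|g K0| in HK.
have Kge0 : 0 <= K by exact: normr_ge0.
move=> eps eps0; exists (eps / (K + 1)); first by rewrite divr_gt0// ltr_wpDl.
move=> m u v Huv _ Hsum.
apply: (@le_lt_trans _ _ (\sum_(i < m) K * (v i - u i))).
  apply: ler_sum => i _; have [au uv vb] := Huv i.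
  have [z zI ->] := @MVT_segment R f g (u i) (v i) uv (fun x _ => fg x)
    (continuous_subspaceT (is_derive_continuous fg)).
  have vu : 0 <= v i - u i by rewrite subr_ge0.
  rewrite normrM (ger0_norm vu) ler_wpM2r//.
  by apply: HK; move: zI; rewrite !in_itv/= => /andP[? ?]; apply/andP; split; lra.
rewrite -mulr_sumr; set S := \sum_(i < m) _ in Hsum *.
have S0 : 0 <= S by apply: sumr_ge0 => i _; have [_ ? _] := Huv i; rewrite subr_ge0.
move: Hsum; rewrite ltr_pdivlMr; last lra.
by apply: le_lt_trans; rewrite mulrDr mulr1 mulrC lerDl.
Qed.

Lemma smoothing_in_W p s h f (M : R) : 1 <= p -> (0 < s)%N -> 0 < h -> borel_Lp p f ->
  (forall t, 0 < t <= s.+1%:R * h -> (Lp_enorm p (finite_diff s t f) <= M%:E)%E) ->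
  in_W p s (smoothing s.+1 h f 0).
Proof.
move=> p1 s0 h0 fL HM; have fi := borel_Lp_interval_integrable p1 fL.
have [mf pf _] := fL.
have E k : (k < s.+1)%N -> (smoothing s.+1 h f 0)^`(k)%classic = smoothing s.+1 h f k.
  exact: derive1n_smoothing.
split.
- exact: smoothing_periodic.
- move=> k ks t; rewrite E; last by rewrite ltnS (leq_trans (ltnW ks))// leq_pred.
  have ks' : (k.+1 < s.+1)%N by rewrite ltnS (leq_trans ks)// leq_pred.
  by have [] := smoothing_is_derive t h0 fi ks'.
- rewrite E; last by rewrite ltnS leq_pred.
  apply: (@is_derive_absolutely_continuous _ (smoothing s.+1 h f s)) => //.
    by move=> x; have := @smoothing_is_derive R s.+1 h f s.-1 x h0 fi; rewrite prednK//; apply.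
  exact: smoothing_continuous.
- rewrite E//; split.
  + apply: borel_lmeasurable; apply: continuous_measurable_fun.
    exact: smoothing_continuous.
  + exact: smoothing_periodic.
  + by apply: le_lt_trans (Lp_enorm_smoothing_le p1 h0 fL HM) _; exact: ltry.
Qed.

(** The intermediate point is given as a fraction [th] of the increment, which
    treats both signs of [h] at once. *)
Lemma mean_value f g y h : (forall x, is_derive x 1 f (g x)) ->
  exists2 th, 0 <= th <= 1 & f (y + h) - f y = g (y + th * h) * h.
Proof.
move=> fg; have cf := continuous_subspaceT (is_derive_continuous fg).
have [h0|h0|->] := ltgtP h 0; last by exists 0; rewrite ?lexx ?ler01// addr0 subrr mulr0.
- have [|z zI E] := @MVT_segment R f g (y + h) y _ (fun x _ => fg x) (cf _); first lra.
  move: zI; rewrite in_itv/= => /andP[z1 z2].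
  exists ((z - y) / h).
    by rewrite ler_ndivlMr// ler_ndivrMr// mul0r mul1r; apply/andP; split; lra.
  by rewrite divfK ?lt_eqF// (addrC y (z - y)) subrK -[LHS]opprB E; ring.
- have [|z zI E] := @MVT_segment R f g y (y + h) _ (fun x _ => fg x) (cf _); first lra.
  move: zI; rewrite in_itv/= => /andP[z1 z2].
  exists ((z - y) / h).
    by rewrite ler_pdivlMr// ler_pdivrMr// mul0r mul1r; apply/andP; split; lra.
  by rewrite divfK ?gt_eqF// (addrC y (z - y)) subrK E; ring.
Qed.

Lemma itv_convex c d y h n th : c <= y <= d -> c <= y + n * h <= d -> 0 <= th <= n ->
  c <= y + th * h <= d.
Proof.
move=> /andP[cy yd] /andP[cn nd] /andP[t0 tn].
have [h0|h0] := leP 0 h.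
  have : 0 <= th * h <= n * h by rewrite mulr_ge0//= ler_wpM2r.
  by move=> /andP[? ?]; apply/andP; split; lra.
have : n * h <= th * h <= 0 by rewrite mulr_ge0_le0 ?(ltW h0)// andbT ler_wnM2r// ltW.
by move=> /andP[? ?]; apply/andP; split; lra.
Qed.

Lemma increment_le_integral f g c d y z : (forall x, is_derive x 1 f (g x)) -> continuous g ->
  c <= y <= d -> c <= z <= d -> `|f z - f y| <= \int[mu]_(t in `[c, d]) `|g t|.
Proof.
move=> fg cg; wlog yz : y z / y <= z.
  move=> H yI zI; have [yz|/ltW zy] := leP y z; first exact: H.
  by rewrite distrC; exact: H.
move=> /andP[cy yd] /andP[cz zd].
have gi := continuous_interval_integrable cg.
have ngi : interval_integrable (fun t => `|g t|).
  apply: continuous_interval_integrable => x.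
  by apply: (@continuous_comp _ _ _ g Num.norm); [exact: cg|exact: norm_continuous].
move: yz; rewrite le_eqVlt => /predU1P[->|yz].
  by rewrite subrr normr0; apply: Rintegral_ge0.
have cf := is_derive_continuous fg.
have -> : f z - f y = \int[mu]_(t in `[y, z]) g t.
  rewrite /Rintegral (@continuous_FTC2 R g f y z yz)//.
  - exact: continuous_subspaceT.
  - split.
    + by move=> x _; have [] := fg x.
    + by apply: cvg_at_right_filter; exact: cf.
    + by apply: cvg_at_left_filter; exact: cf.
  - by move=> x _; rewrite derive1E; apply: derive_val.
apply: le_trans (le_normr_Rintegral _ _) _ => //; first exact: interval_integrableP.
rewrite /Rintegral fine_le//.
- by apply: integrable_fin_num => //; exact: interval_integrableP.
- by apply: integrable_fin_num => //; exact: interval_integrableP.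
apply: ge0_subset_integral => //.
  by apply/measurable_EFinP; apply: measurable_funTS; case: ngi.
by move=> x /=; rewrite !in_itv/= => /andP[? ?]; apply/andP; split; lra.
Qed.

(** The mean value theorem lowers the order of the difference by one and gives
    a factor [h], as long as a derivative is left; the last first difference
    is an integral. Using the integral at the last step, and not the maximum,
    is what gives an [L_p] bound later. *)
Lemma finite_diff_le_integral (G : nat -> R -> R) s c d y h :
  (forall k, (k <= s)%N -> forall x, is_derive x 1 (G k) (G k.+1 x)) -> continuous (G s.+1) ->
  c <= y <= d -> c <= y + s.+1%:R * h <= d ->
  `|finite_diff s.+1 h (G 0%N) y| <= `|h| ^+ s * \int[mu]_(t in `[c, d]) `|G s.+1 t|.
Proof.
elim: s G y => [|s IH] G y dG cG yI yhI.
  rewrite finite_diffS !finite_diff0 expr0 mul1r.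
  by apply: increment_le_integral => //; [exact: dG|rewrite -(mul1r h)].
rewrite finite_diffS.
have [th /andP[th0 th1] ->] := mean_value y h (finite_diff_is_derive s.+1 h (dG 0%N (leq0n _))).
rewrite normrM mulrC exprS -mulrA ler_wpM2l//.
apply: (IH (fun k => G k.+1)) => //.
- by move=> k ks; exact: dG.
- apply: itv_convex yI yhI _; by rewrite th0/= (le_trans th1)// ler1n.
- rewrite -addrA -mulrDl; apply: itv_convex yI yhI _.
  by rewrite addr_ge0//= -[leRHS]natr1 addrC lerD2l.
Qed.

(** In [finite_diffS] both differences of lower order have all their points of
    evaluation in the interval, by convexity. *)
Lemma finite_diff_addn_le f s k c d h B y :
  (forall z, c <= z <= d -> c <= z + s%:R * h <= d -> `|finite_diff s h f z| <= B) ->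
  c <= y <= d -> c <= y + (s + k)%:R * h <= d ->
  `|finite_diff (s + k) h f y| <= 2 ^+ k * B.
Proof.
move=> H; elim: k y => [|k IH] y yI yhI.
  by rewrite addn0 expr0 mul1r; apply: H => //; rewrite addn0 in yhI.
rewrite addnS finite_diffS; apply: le_trans (ler_normB _ _) _.
rewrite exprS -mulrA mulr_natl mulr2n lerD//; apply: IH => //.
- rewrite -[h in y + h]mul1r; apply: itv_convex yI yhI _.
  by rewrite ler01/= ler1n addnS.
- rewrite -addrA -[X in y + (X + _)]mul1r -mulrDl; apply: itv_convex yI yhI _.
  by rewrite addr_ge0//= addnS -[leRHS]natr1 addrC.
- apply: itv_convex yI yhI _; rewrite ler0n/= ler_nat addnS //.
Qed.
End pointwise.

(** * Steklov averages of integrable functions *)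

Section steklov.
Context {R : realType}.
Implicit Types (a b c d p x y z h u : R) (f g w : R -> R) (s m k r : nat).
Local Notation mu := (@lebesgue_measure R).

(** Preimages of null sets under an affine bijection are null. *)
Lemma ae_affine a b (P : R -> Prop) : a != 0 ->
  {ae mu, forall x, P x} -> {ae mu, forall x, P (a * x + b)}.
Proof.
move=> a0 [N [mN N0 NP]]; exists ((fun x : R => a * x + b) @^-1` N); split.
- by rewrite -[X in measurable X]setTI; apply: measurable_affine.
- have := lebesgue_measure_affine b a0 mN; rewrite N0 => /eqP.
  by rewrite mule_eq0 eqe normr_eq0 (negbTE a0)/= => /eqP.
- by move=> x /= H; apply: NP.
Qed.

Lemma ae_sum_eq (I : Type) (l : seq I) (F G : I -> R -> R) :
  (forall i, {ae mu, forall x, F i x = G i x}) ->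
  {ae mu, forall x, \sum_(i <- l) F i x = \sum_(i <- l) G i x}.
Proof.
move=> H; elim: l => [|i l IH].
  exists set0; split; [by []|exact: measure0|].
  by move=> x /=; apply; rewrite !big_nil.
have := negligibleU (H i) IH; apply: negligibleS => x /=.
rewrite -not_andP; apply: contra_not => -[/= E1 E2].
by rewrite !big_cons E1 E2.
Qed.

(** Only finitely many translates of a null set are involved. *)
Lemma finite_diff_ae s h f g : {ae mu, forall x, f x = g x} ->
  {ae mu, forall x, finite_diff s h f x = finite_diff s h g x}.
Proof.
move=> fg; apply: ae_sum_eq => i.
have := @ae_affine 1 ((s - i)%:R * h) (fun x => f x = g x) (oner_neq0 _) fg.
apply: negligibleS => x /=; apply: contra_not; by rewrite mul1r => ->.
Qed.

Definition steklov_integrand r f x u :=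
  \sum_(nu < r) (-1) ^+ nu * 'C(2 * r, nu)%:R * f (x + (r - nu)%:R / r%:R * u).

Lemma interval_integrable_steklov_integrand r f x : interval_integrable f ->
  interval_integrable (steklov_integrand r f x).
Proof.
move=> fi; apply: interval_integrable_sum => i; apply: interval_integrableZ.
by under eq_fun do rewrite addrC; exact: interval_integrable_affine.
Qed.

(** The Steklov average depends only on the class of [f] modulo null sets: for
    each [nu] the points [x + (r - nu) / r * u] run over a nondegenerate affine
    image of the variable. *)
Lemma steklovE delta r f g x : {ae mu, forall x, f x = g x} -> interval_integrable g ->
  steklov delta r f x = (-1) ^+ r.+1 * ('C(2 * r, r)%:R)^-1 * (2 / delta) *
  \int[mu]_(u in `[- (delta / 2), delta / 2]) steklov_integrand r g x u.
Proof.
move=> fg gi; rewrite /steklov; congr (_ * _).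
have [mgi _] := interval_integrable_steklov_integrand r x gi.
have E : {ae mu, forall u, steklov_integrand r f x u = steklov_integrand r g x u}.
  apply: ae_sum_eq => i.
  have c0 : (r - i)%:R / r%:R != 0 :> R.
    by rewrite mulf_neq0// ?invr_eq0 pnatr_eq0 -lt0n ?subn_gt0// (leq_ltn_trans _ (ltn_ord i)).
  have := @ae_affine ((r - i)%:R / r%:R) x (fun x => f x = g x) c0 fg.
  by apply: negligibleS => u /=; apply: contra_not; rewrite addrC => ->.
rewrite /Rintegral; apply: (congr1 fine).
rewrite -integral_completed//; last exact/measurable_EFinP.
apply: (@ae_eq_integral _ (lebesgueType R) R (@completed_lebesgue_measure R)).
- exact: sub_caratheodory.
- by apply/measurable_EFinP; apply: measurable_funTS; exact: (ae_lmeasurable mgi).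
- by apply/measurable_EFinP; apply: measurable_funTS; exact: borel_lmeasurable.
- have [N [mN N0 NP]] := ae_completed E; exists N; split; [exact: mN|exact: N0|].
  by apply: subset_trans NP => u /= H Eu; apply: H => _; congr EFin.
Qed.

Lemma interval_integrable_norm f : interval_integrable f -> interval_integrable (fun x => `|f x|).
Proof.
move=> [mf fi]; split; first exact: measurableT_comp.
by move=> a b; under eq_integral do rewrite normr_id; exact: fi.
Qed.

Lemma le_Rintegral_itv f a b c d : interval_integrable f -> (forall x, 0 <= f x) ->
  c <= a -> b <= d -> \int[mu]_(t in `[a, b]) f t <= \int[mu]_(t in `[c, d]) f t.
Proof.
move=> fi f0 ca bd; rewrite /Rintegral fine_le//.
- by apply: integrable_fin_num => //; exact: interval_integrableP.
- by apply: integrable_fin_num => //; exact: interval_integrableP.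
apply: ge0_subset_integral => //.
  by apply/measurable_EFinP; apply: measurable_funTS; case: fi.
  by move=> x _; rewrite lee_fin.
by move=> x /=; rewrite !in_itv/= => /andP[? ?]; apply/andP; split; lra.
Qed.

(** As [c <= 1], the image of the interval stays inside the interval of
    half-length [d]; the factor [c^-1] comes from the change of variable. *)
Lemma Rintegral_dilation_le w x c d : 0 < c -> c <= 1 -> 0 <= d -> interval_integrable w ->
  `|\int[mu]_(u in `[- d, d]) w (x + c * u)| <= c^-1 * \int[mu]_(t in `[x - d, x + d]) `|w t|.
Proof.
move=> c0 c1 d0 wi.
have nwi := interval_integrable_norm wi.
have wci : interval_integrable (fun u => w (x + c * u)).
  by under eq_fun do rewrite addrC; exact: interval_integrable_affine.
apply: le_trans (le_normr_Rintegral _ (interval_integrableP _ _ wci)) _ => //.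
have := Rintegral_affine x (x - c * d) (x + c * d) (lt0r_neq0 c0) nwi.
rewrite (_ : _ @^-1` _ = `[- d, d]%classic); last first.
  apply/seteqP; split => u /=; rewrite !in_itv/= => /andP[h1 h2].
    have : c * (- d) <= c * u <= c * d by apply/andP; split; lra.
    by rewrite !ler_pM2l.
  have : c * (- d) <= c * u <= c * d by rewrite !ler_pM2l// h1.
  by move=> /andP[? ?]; apply/andP; split; lra.
under eq_Rintegral do rewrite addrC.
move=> ->; rewrite (gtr0_norm c0) ler_wpM2l ?invr_ge0 ?(ltW c0)//.
have cd : c * d <= d by rewrite ler_piMl.
by apply: le_Rintegral_itv => //; lra.
Qed.

(** Each of the [r] terms is a mean over a shorter interval with the same
    centre. The constant is crude: [(r - nu) / r] is at least [1 / r] and the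
    binomial coefficients add up to at most [2 ^ (2 r)]. *)
Lemma steklov_bound delta r w x : 0 < delta -> (0 < r)%N -> interval_integrable w ->
  `|steklov delta r w x| <=
  (2 ^+ (2 * r) * r%:R * 2) / delta * \int[mu]_(t in `[x - delta / 2, x + delta / 2]) `|w t|.
Proof.
move=> delta0 r0 wi.
have d0 : 0 < delta / 2 by rewrite divr_gt0.
set I := \int[mu]_(t in _) _.
have I0 : 0 <= I by apply: Rintegral_ge0.
have aew : {ae mu, forall x, w x = w x} by exists set0; split; [by []|exact: measure0|move=> y /=; apply].
rewrite (steklovE _ _ _ aew wi).
have C1 : 1 <= 'C(2 * r, r)%:R :> R by rewrite ler1n bin_gt0 leq_pmull.
rewrite !normrM normrX normrN1 expr1n mul1r normfV normr_nat.
rewrite (ger0_norm (ltW (_ : 0 < delta^-1))) ?invr_gt0// (ger0_norm (_ : 0 <= 2))//.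
have H : `|\int[mu]_(u in `[- (delta / 2), delta / 2]) steklov_integrand r w x u| <=
   2 ^+ (2 * r) * r%:R * I.
  rewrite /steklov_integrand Rintegral_sum; last first.
    move=> i; apply: interval_integrableZ.
    by under eq_fun do rewrite addrC; exact: interval_integrable_affine.
  apply: le_trans (ler_norm_sum _ _ _) _.
  apply: (@le_trans _ _ (\sum_(i < r) 'C(2 * r, i)%:R * (r%:R * I))).
    apply: ler_sum => i _; rewrite RintegralZl//; last first.
      apply: interval_integrableP.
      by under eq_fun do rewrite addrC; exact: interval_integrable_affine.
    rewrite normrM normrM normrX normrN1 expr1n mul1r normr_nat ler_wpM2l//.
    have c0 : 0 < (r - i)%:R / r%:R :> R by rewrite divr_gt0// ltr0n ?subn_gt0.
    apply: le_trans (Rintegral_dilation_le _ c0 _ (ltW d0) wi) _.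
      by rewrite ler_pdivrMr ?ltr0n// mul1r ler_nat leq_subr.
    rewrite ler_wpM2r// invf_div ler_pdivrMr ?ltr0n ?subn_gt0//.
    by rewrite ler_peMr// ler1n subn_gt0.
  rewrite -mulr_suml mulrA ler_wpM2r// ler_wpM2r//.
  rewrite -[2]/(1 + 1) exprDn.
  rewrite (big_ord_widen (2 * r).+1 (fun i => 'C(2 * r, i)%:R)) ?ltnS ?leq_pmull//; last first.
    by rewrite (leq_trans (leqnSn r))// ltnS leq_pmull.
  rewrite big_mkcond/=; apply: ler_sum => i _; rewrite !expr1n mulr1.
  by case: ifP.
apply: (@le_trans _ _ (1 * (2 / delta) * (2 ^+ (2 * r) * r%:R * I))).
  apply: ler_pM => //.
    by rewrite mulr_ge0// ?divr_ge0// ?invr_ge0// ltW.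
  by rewrite ler_wpM2r ?divr_ge0 ?(ltW delta0)// invf_le1// (lt_le_trans _ C1).
by rewrite le_eqVlt; apply/orP; left; apply/eqP; ring.
Qed.

End steklov.

(** * Steklov averages of smooth functions *)

Section steklov_smooth.
Context {R : realType}.
Implicit Types (a b c d p x y z h u : R) (f g w : R -> R) (s m k r : nat).
Local Notation mu := (@lebesgue_measure R).

(** The sum of order [2 r] splits at its middle index [r]; reversing the upper
    half gives the lower half with [u] replaced by [- u]. *)
Lemma central_finite_diff r g x u : (0 < r)%N ->
  finite_diff (2 * r) (u / r%:R) g (x - u) =
  steklov_integrand r g x u + steklov_integrand r g x (- u) + (-1) ^+ r * 'C(2 * r, r)%:R * g x.
Proof.
move=> r0; have rn0 : r%:R != 0 :> R by rewrite pnatr_eq0 -lt0n.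
pose F (nu : nat) := (-1) ^+ nu * 'C(2 * r, nu)%:R * g (x + (r%:R - nu%:R) / r%:R * u).
have -> : finite_diff (2 * r) (u / r%:R) g (x - u) = \sum_(0 <= nu < (2 * r).+1) F nu.
  rewrite big_mkord; apply: eq_bigr => i _; rewrite /F (mulrC 'C(_, _)%:R); congr (_ * g _).
  by rewrite natrB; [rewrite natrM; field|rewrite -ltnS].
have -> : steklov_integrand r g x u = \sum_(0 <= nu < r) F nu.
  rewrite big_mkord; apply: eq_bigr => i _; rewrite /F; congr (_ * g _).
  by rewrite natrB// ltnW.
have -> : steklov_integrand r g x (- u) = \sum_(0 <= nu < r) F (2 * r - nu)%N.
  rewrite big_mkord; apply: eq_bigr => i _.
  have ir : (i <= 2 * r)%N by rewrite (leq_trans (ltnW (ltn_ord i)))// leq_pmull.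
  have sg : (-1) ^+ (2 * r - i) = (-1) ^+ i :> R by rewrite -signr_odd oddB// oddM/= signr_odd.
  rewrite /F bin_sub// sg; congr (_ * g _).
  by rewrite natrB ?(ltnW (ltn_ord i))// natrB// natrM; field.
rewrite (@big_cat_nat _ _ _ r)//=; last by rewrite leqW// leq_pmull.
rewrite -addrA; congr (_ + _).
rewrite big_ltn; last by rewrite ltnS leq_pmull.
rewrite addrC; congr (_ + _); last by rewrite /F subrr mul0r mul0r addr0.
rewrite -[r.+1]add0n big_addn (_ : (2 * r).+1 - r.+1 = r)%N; last by rewrite subSS mul2n -addnn addnK.
(* The index [2 r - i] corresponds to [- i] once centred at [r]. *)
rewrite big_nat_rev/= big_nat [RHS]big_nat; apply: eq_bigr => i /andP[_ ir]; congr F.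
rewrite add0n; lia.
Qed.

(** Integrated over a symmetric interval, [central_finite_diff] shows that the
    error is, up to sign, the mean of central differences of order [2 r] divided by
    the central binomial coefficient. All their points of evaluation lie in the
    interval of length [delta] centred at [x]. *)
Lemma steklov_smooth_error delta r s (G : nat -> R -> R) x :
  0 < delta -> (0 < r)%N -> (s.+1 <= 2 * r)%N ->
  (forall k, (k <= s)%N -> forall y, is_derive y 1 (G k) (G k.+1 y)) -> continuous (G s.+1) ->
  `|steklov delta r (G 0%N) x - G 0%N x| <=
   2 ^+ (2 * r - s.+1) * delta ^+ s * \int[mu]_(t in `[x - delta / 2, x + delta / 2]) `|G s.+1 t|.
Proof.
move=> delta0 r0 sr dG cG; set g := G 0%N; set B := (X in _ <= X).
have cg : continuous g by exact: (is_derive_continuous (dG 0%N (leq0n _))).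
have gi := continuous_interval_integrable cg.
have d0 : 0 < delta / 2 by rewrite divr_gt0.
set d := delta / 2 in d0 B *.
have dd : d + d = delta by rewrite /d -splitr.
set P := steklov_integrand r g x.
have Pi : interval_integrable P by exact: interval_integrable_steklov_integrand.
have PNi : interval_integrable (fun u => P (- u)).
  have := interval_integrable_affine (-1) 0 Pi.
  by under eq_fun do rewrite mulN1r addr0.
have ae : {ae mu, forall x, g x = g x} by exists set0; split; [by []|exact: measure0|move=> y /=; apply].
pose D u := finite_diff (2 * r) (u / r%:R) g (x - u).
pose C : R := 'C(2 * r, r)%:R.
have C1 : 1 <= C by rewrite ler1n bin_gt0 leq_pmull.
have DE : D = fun u => P u + P (- u) + (-1) ^+ r * C * g x.
  by apply/funext => u; rewrite /D central_finite_diff.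
have ci : interval_integrable (fun=> (-1) ^+ r * C * g x).
  by apply: continuous_interval_integrable => y; exact: cvg_cst.
have PPi := interval_integrableD Pi PNi.
have Di : interval_integrable D by rewrite DE; exact: interval_integrableD.
have mudd : fine (mu `[- d, d]%classic) = delta.
  by rewrite lebesgue_measure_itv/= lte_fin gtrN// -EFinB/= opprK dd.
have IPN : \int[mu]_(u in `[- d, d]) P (- u) = \int[mu]_(u in `[- d, d]) P u.
  have := @Rintegral_affine R (-1) 0 P (- d) d _ Pi.
  rewrite normrN1 invr1 mul1r => <-; last by rewrite oppr_eq0 oner_eq0.
  rewrite (_ : _ @^-1` _ = `[- d, d]%classic).
    by apply: eq_Rintegral => u _; rewrite mulN1r addr0.
  by apply/seteqP; split => u /=; rewrite !in_itv/= => /andP[? ?]; apply/andP; split; lra.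
have ID : \int[mu]_(u in `[- d, d]) D u =
    2 * \int[mu]_(u in `[- d, d]) P u + (-1) ^+ r * C * g x * delta.
  rewrite DE RintegralD//; [|exact: interval_integrableP|exact: interval_integrableP].
  rewrite RintegralD//; [|exact: interval_integrableP|exact: interval_integrableP].
  by rewrite IPN Rintegral_cst// mudd; ring.
have -> : steklov delta r g x - g x = (-1) ^+ r.+1 * C^-1 * delta^-1 * \int[mu]_(u in `[- d, d]) D u.
  rewrite (steklovE _ _ _ ae gi) -/d -/P -/C ID exprS.
  have e2 : (-1) ^+ r * (-1) ^+ r = 1 :> R by rewrite -expr2 sqrr_sign.
  set J := \int[mu]_(u in _) P u; set e := (-1) ^+ r in e2 *.
  rewrite mulrDr; congr (_ + _); first by ring.
  rewrite [RHS](_ : _ = - (e * e) * (C^-1 * C) * (delta^-1 * delta) * g x); last by ring.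
  by rewrite e2 !mulVf ?gt_eqF ?(lt_le_trans _ C1)//; ring.
have B0 : 0 <= B.
  by rewrite mulr_ge0// ?mulr_ge0 ?exprn_ge0 ?(ltW delta0)//; apply: Rintegral_ge0.
have DB u : u \in `[- d, d] -> `|D u| <= B.
  rewrite in_itv/= => /andP[du ud].
  rewrite /D -(subnKC sr) /B -mulrA; apply: (@finite_diff_addn_le R g s.+1 _ (x - d) (x + d)).
  - move=> z zI zhI.
    apply: le_trans (finite_diff_le_integral dG cG zI zhI) _.
    rewrite ler_wpM2r//; first by apply: Rintegral_ge0.
    apply: lerXn2r; rewrite ?nnegrE ?normr_ge0 ?(ltW delta0)//.
    rewrite normrM normfV normr_nat ler_pdivrMr ?ltr0n//.
    have : `|u| <= delta by rewrite ler_norml; apply/andP; split; lra.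
    by move=> /le_trans; apply; rewrite ler_peMr ?ler1n// ltW.
  - by apply/andP; split; lra.
  - rewrite subnKC// natrM (_ : x - u + _ = x + u); first by apply/andP; split; lra.
    by field; rewrite pnatr_eq0 -lt0n.
rewrite !normrM normrX normrN1 expr1n mul1r !normfV (gtr0_norm delta0) (ger0_norm (le_trans ler01 C1)).
have HI : `|\int[mu]_(u in `[- d, d]) D u| <= B * delta.
  apply: le_trans (le_normr_Rintegral _ (interval_integrableP _ _ Di)) _ => //.
  have -> : B * delta = \int[mu]_(u in `[- d, d]) B by rewrite Rintegral_cst// mudd.
  apply: le_Rintegral => //.
  - exact: (interval_integrableP _ _ (interval_integrable_norm Di)).
  - apply: (interval_integrableP (f := fun=> B)).
    by apply: continuous_interval_integrable => y; exact: cvg_cst.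
apply: (@le_trans _ _ (1 * delta^-1 * (B * delta))).
  apply: ler_pM => //; first by rewrite mulr_ge0// invr_ge0// ?(ltW delta0)// (le_trans ler01).
  rewrite ler_wpM2r ?invr_ge0 ?(ltW delta0)// invf_le1//.
  exact: lt_le_trans C1.
by rewrite mul1r mulrC -mulrA divff ?mulr1// gt_eqF.
Qed.

End steklov_smooth.

(** * Local means at separated nodes *)

Section nodes.
Context {R : realType}.
Implicit Types (a b c d p : R) (f g w v : R -> R) (n : nat) (x : nat -> nat -> R).
Local Notation mu := (@lebesgue_measure R).

Lemma ge0_integral_itvco_sum (w : R -> \bar R) (y : nat -> R) n :
  measurable_fun setT w -> (forall t, 0 <= w t)%E ->
  (forall k, (1 <= k <= n)%N -> y k <= y k.+1) ->
  (\sum_(1 <= k < n.+1) \int[mu]_(t in `[y k, y k.+1[) w t =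
   \int[mu]_(t in `[y 1%N, y n.+1[) w t)%E.
Proof.
move=> mw w0 yy.
suff : y 1%N <= y n.+1 /\ (\sum_(1 <= k < n.+1) \int[mu]_(t in `[y k, y k.+1[) w t =
   \int[mu]_(t in `[y 1%N, y n.+1[) w t)%E by case.
elim: n yy => [|n IH] yy.
  by rewrite lexx big_geq// set_itvco0 integral_set0.
have [|yn E] := IH.
  by move=> k /andP[k1 kn]; apply: yy; rewrite k1 leqW.
have yS : y n.+1 <= y n.+2 by apply: yy; rewrite leqnn.
split; first exact: le_trans yS.
by rewrite big_nat_recr//= E [RHS](@ge0_integral_itvco_split R w _ (y n.+1)).
Qed.

(** By separation the interval around the [k]-th node ends before the one around
    the next node begins, and the last one ends before the period that starts at
    the left end of the first one is over. *)
Lemma sum_node_integral_le p gamma x n w : (0 < n)%N -> 0 < gamma -> separated_nodes gamma x ->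
  measurable_fun setT w -> periodic w 1 ->
  (\sum_(1 <= k < n.+1) \int[mu]_(t in `[(x n k - gamma / n%:R / 2)%R, (x n k + gamma / n%:R / 2)%R])
     (`|w t| `^ p)%:E <= \int[mu]_(t in `[0%R, 1%R[) (`|w t| `^ p)%:E)%E.
Proof.
move=> n0 gamma0 sx mw pw; set d := gamma / n%:R / 2.
have d0 : 0 < d by rewrite !divr_gt0// ltr0n.
have [_ _ _ xn1 xsep] := sx n n0.
have dd : d + d = gamma / n%:R by rewrite /d -splitr.
have mE : measurable_fun setT (fun t => (`|w t| `^ p)%:E) by exact: measurable_powR_norm.
have E0 t : (0 <= (`|w t| `^ p)%:E)%E by rewrite lee_fin powR_ge0.
pose y k := x n k - d.
have yS k : (1 <= k <= n)%N -> x n k + d <= y k.+1.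
  by move=> kn; have := xsep k kn; rewrite /y -dd; lra.
rewrite -(ge0_integral_period (x n 1%N - d) mE E0); last by move=> t; rewrite pw.
have -> : x n 1%N - d + 1 = y n.+1 by rewrite /y xn1; ring.
rewrite -(ge0_integral_itvco_sum mE E0); last first.
  by move=> k kn; apply: le_trans (yS k kn); rewrite /y; lra.
rewrite big_nat [leRHS]big_nat; apply: lee_sum => k; rewrite ltnS => kn.
rewrite -integral_itv_bndo_bndc; last exact: measurable_funTS.
apply: ge0_subset_integral => //; first exact: measurable_funTS.
apply: subset_itvl; rewrite bnd_simp; exact: yS.
Qed.

(** Jensen's inequality on each interval and the fact that the intervals fit in
    one period; [n * (gamma / n) = gamma] explains the constant. *)
Lemma lp_norm_le_local_mean p gamma K x n v w :
  1 <= p -> (0 < n)%N -> 0 < gamma -> 0 <= K -> separated_nodes gamma x -> borel_Lp p w ->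
  (forall k, (1 <= k <= n)%N -> `|v (x n k)| <= K / (gamma / n%:R) *
     \int[mu]_(t in `[x n k - gamma / n%:R / 2, x n k + gamma / n%:R / 2]) `|w t|) ->
  lp_norm p x n v <= K * gamma^-1 `^ p^-1 * Lp_norm p w.
Proof.
move=> p1 n0 gamma0 K0 sx [mw pw fw] H; set delta := gamma / n%:R in H.
have p0 : 0 < p by exact: lt_le_trans p1.
have nn0 : 0 < n%:R :> R by rewrite ltr0n.
have delta0 : 0 < delta by rewrite divr_gt0.
have Kd0 : 0 <= K / delta by rewrite mulr_ge0// invr_ge0 ltW.
move: fw; rewrite /Lp_norm (Lp_enormE p0 mw).
have := sum_node_integral_le p n0 gamma0 sx mw pw; rewrite -/delta.
set E := (\int[mu]_(t in `[0%R, 1%R[) _)%E => HE.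
have E0 : (0 <= E)%E by apply: integral_ge0 => t _; rewrite lee_fin powR_ge0.
move=> /lty_poweRy; rewrite invr_eq0 gt_eqF// => /(_ isT) Efin.
have EE : E = (fine E)%:E by rewrite fineK// ge0_fin_numE.
set e := fine E in EE; rewrite EE in HE *.
have e0 : 0 <= e by rewrite -lee_fin -EE.
rewrite poweR_EFin /=.
have S : \sum_(1 <= k < n.+1) `|v (x n k)| `^ p <= (K / delta) `^ p * (delta `^ (p - 1) * e).
  rewrite -lee_fin -sumEFin.
  apply: (@le_trans _ _ (\sum_(1 <= k < n.+1) ((K / delta) `^ p)%:E * ((delta `^ (p - 1))%:E *
    \int[mu]_(t in `[(x n k - delta / 2)%R, (x n k + delta / 2)%R]) (`|w t| `^ p)%:E))%E).
    rewrite big_nat [leRHS]big_nat; apply: lee_sum => k; rewrite ltnS => kn.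
    pose D : set R := `[x n k - delta / 2, x n k + delta / 2]%classic.
    have mD : measurable D by exact: measurable_itv.
    have muD : mu D = delta%:E.
      rewrite /D lebesgue_measure_itv/= lte_fin ifT; last by lra.
      by rewrite -EFinB; congr EFin; lra.
    have mnw : measurable_fun setT (fun t => `|w t|) by exact: measurableT_comp.
    have := @powR_Rintegral_le _ _ _ mu D delta mD muD p _ p1 mnw.
    under [X in (_ <= _ * X)%E -> _]eq_integral do rewrite normr_id.
    move=> J; apply: le_trans (lee_wpmul2l _ J); last by rewrite lee_fin powR_ge0.
    rewrite -EFinM lee_fin -powRM ?normr_ge0 ?Kd0//.
    apply: ge0_ler_powR; rewrite ?nnegrE ?normr_ge0 ?(ltW p0)//.
      exact: mulr_ge0.
    apply: le_trans (H k kn) _; rewrite ler_wpM2l//.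
    exact: ler_norm.
  rewrite -ge0_sume_distrr; last first.
    by move=> k _; rewrite mule_ge0 ?lee_fin ?powR_ge0//; apply: integral_ge0 => t _; rewrite lee_fin powR_ge0.
  rewrite EFinM lee_wpmul2l ?lee_fin ?powR_ge0//.
  rewrite -ge0_sume_distrr; last first.
    by move=> k _; apply: integral_ge0 => t _; rewrite lee_fin powR_ge0.
  by rewrite EFinM lee_wpmul2l ?lee_fin ?powR_ge0.
rewrite /lp_norm.
have -> : K * gamma^-1 `^ p^-1 * e `^ p^-1 = (K `^ p * (gamma^-1 * e)) `^ p^-1.
  rewrite powRM ?powR_ge0 ?mulr_ge0 ?invr_ge0 ?(ltW gamma0)//.
  rewrite powRM ?invr_ge0 ?(ltW gamma0)// -powRrM mulfV ?gt_eqF// powRr1// mulrA//.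
apply: ge0_ler_powR; rewrite ?nnegrE ?invr_ge0 ?(ltW p0)//.
- by rewrite mulr_ge0// ?invr_ge0//; apply: sumr_ge0 => k _; exact: powR_ge0.
- by rewrite !mulr_ge0// ?powR_ge0// invr_ge0 ltW.
apply: le_trans (ler_wpM2l _ S) _; first by rewrite invr_ge0.
rewrite powRM ?invr_ge0 ?(ltW delta0)//.
have pd : delta `^ (p - 1) = delta `^ p * delta^-1.
  by rewrite powRB ?powRr1 ?(ltW delta0)// (gt_eqF delta0) implybT.
have dp0 : delta `^ p != 0 by rewrite gt_eqF// powR_gt0.
have -> : delta^-1 `^ p = (delta `^ p)^-1.
  by rewrite -(powR_inv1 (ltW delta0)) -powRrM mulN1r powRN.
rewrite pd le_eqVlt; apply/orP; left; apply/eqP.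
have gn0 : gamma != 0 by rewrite gt_eqF.
rewrite /delta invf_div; rewrite -/delta; field.
by rewrite gn0 dp0 gt_eqF.
Qed.
End nodes.

(** * Smooth approximation at the scale of the nodes *)

Section approximation.
Context {R : realType}.
Implicit Types (a b c d p t : R) (f g w : R -> R) (n r s : nat) (x : nat -> nat -> R).
Local Notation mu := (@lebesgue_measure R).

Lemma Lp_norm_fineK p f : (Lp_enorm p f < +oo)%E -> (Lp_norm p f)%:E = Lp_enorm p f.
Proof. by move=> fp; rewrite /Lp_norm fineK// ge0_fin_numE// Lp_enorm_ge0. Qed.

Lemma Lp_norm_le p f c : (Lp_enorm p f <= c%:E)%E -> Lp_norm p f <= c.
Proof. by move=> H; rewrite -lee_fin Lp_norm_fineK// (le_lt_trans H)// ltry. Qed.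

(** The modulus of smoothness is a supremum in the reals, so it bounds its
    elements only because the set is bounded, here by [2 ^ s] times the norm
    of the function. *)
Lemma Lp_norm_le_smoothness s p f f0 c t : 1 <= p ->
  borel_Lp p f0 -> {ae mu, forall y, f y = f0 y} -> 0 < t < c ->
  (Lp_enorm p (finite_diff s t f0) <= (smoothness s p f c)%:E)%E.
Proof.
move=> p1 [mf0 pf0 f0p] ff0 tc; have p0 : 0 < p by exact: lt_le_trans p1.
have E u : Lp_enorm p (finite_diff s u f) = Lp_enorm p (finite_diff s u f0).
  apply: Lp_enorm_ae => //; first exact: measurable_finite_diff.
  exact: finite_diff_ae.
have fin u : (Lp_enorm p (finite_diff s u f0) <= (2 ^+ s * Lp_norm p f0)%:E)%E.
  by rewrite EFinM Lp_norm_fineK//; exact: Lp_enorm_finite_diff_le.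
rewrite -E -Lp_norm_fineK; last by rewrite E (le_lt_trans (fin t))// ltry.
rewrite lee_fin; apply: ub_le_sup; last by exists t => //; rewrite /= in_itv.
exists (2 ^+ s * Lp_norm p f0) => _ [u _ <-].
by apply: Lp_norm_le; rewrite E.
Qed.

Lemma Lp_enorm_norm p f : Lp_enorm p (fun y => `|f y|) = Lp_enorm p f.
Proof.
rewrite /Lp_enorm -[RHS]Lnorm_abse; apply: eq_Lnorm => y /=.
by rewrite normrM; congr (_ * _)%:E; rewrite ger0_norm// indicE ler0n.
Qed.

Lemma steklovB delta r f f0 g y : {ae mu, forall z, f z = f0 z} ->
  interval_integrable f0 -> interval_integrable g ->
  steklov delta r f y = steklov delta r (fun z => f0 z - g z) y + steklov delta r g y.
Proof.
move=> ff0 f0i gi.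
have refl (u : R -> R) : {ae mu, forall z, u z = u z}.
  by exists set0; split; [by []|exact: measure0|move=> z /=; apply].
have fgi : interval_integrable (fun z => f0 z - g z).
  under eq_fun do rewrite -mulN1r.
  by apply: interval_integrableD => //; exact: interval_integrableZ.
rewrite (steklovE _ _ _ ff0 f0i) (steklovE _ _ _ (refl _) fgi) (steklovE _ _ _ (refl _) gi).
rewrite -mulrDr -RintegralD//.
- congr (_ * _); apply: eq_Rintegral => u _.
  by rewrite /steklov_integrand -big_split/=; apply: eq_bigr => i _; ring.
- exact/interval_integrableP/interval_integrable_steklov_integrand.
- exact/interval_integrableP/interval_integrable_steklov_integrand.
Qed.

(** The step [h = 1 / ((s + 2) n)] is chosen so that all differences involved
    have steps at most [(s + 1) h < 1 / n], as the modulus of smoothness is a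
    supremum over steps strictly less than [1 / n]. *)
Lemma smooth_approximation p gamma r s f f0 : 1 <= p -> (0 < r)%N -> (0 < s)%N -> (s <= 2 * r)%N ->
  0 < gamma <= 1 -> borel_Lp p f0 -> {ae mu, forall y, f y = f0 y} ->
  exists2 C, 0 <= C & forall n x, (0 < n)%N -> separated_nodes gamma x ->
    exists g, [/\ in_W p s g /\ borel_Lp p g,
      Lp_norm p (f \- g) <= C * smoothness s p f n%:R^-1,
      (n%:R ^+ s)^-1 * Lp_norm p (g^`(s))%classic <= C * smoothness s p f n%:R^-1 &
      lp_norm p x n (steklov (gamma / n%:R) r f \- g) <= C * smoothness s p f n%:R^-1].
Proof.
move=> p1 r0 s0 sr /andP[gamma0 gamma1] f0L ff0.
have p0 : 0 < p by exact: lt_le_trans p1.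
have f0i := borel_Lp_interval_integrable p1 f0L.
have [mf0 pf0 f0p] := f0L.
pose C1 : R := 2 ^+ s.+1 * s.+2%:R ^+ s.
pose K : R := 2 ^+ (2 * r) * r%:R * 2 + 2 ^+ (2 * r - s).
have C10 : 0 <= C1 by rewrite mulr_ge0 ?exprn_ge0.
have K0 : 0 <= K by rewrite addr_ge0 ?exprn_ge0// !mulr_ge0 ?exprn_ge0.
pose C3 : R := K * gamma^-1 `^ p^-1 * (2 + C1).
have C30 : 0 <= C3 by rewrite !mulr_ge0 ?powR_ge0// addr_ge0.
exists (2 + C1 + C3); first by rewrite !addr_ge0.
move=> n x n0 sx; set omega := smoothness s p f n%:R^-1.
have nn0 : 0 < n%:R :> R by rewrite ltr0n.
pose h : R := (s.+2%:R * n%:R)^-1.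
have h0 : 0 < h by rewrite invr_gt0 mulr_gt0.
have sh : s.+1%:R * h < n%:R^-1.
  rewrite /h invfM mulrA gtr_pMl ?invr_gt0// ltr_pdivrMr// mul1r ltr_nat//.
have Hs t : 0 < t <= s.+1%:R * h -> (Lp_enorm p (finite_diff s t f0) <= omega%:E)%E.
  move=> /andP[t0 th]; apply: Lp_norm_le_smoothness => //.
  by rewrite t0 (le_lt_trans th).
have omega0 : 0 <= omega.
  rewrite -lee_fin; apply: le_trans (Hs (s.+1%:R * h) _); first exact: Lp_enorm_ge0.
  by rewrite lexx andbT mulr_gt0.
(* The step 0 is not covered by the modulus, but the difference is then 0. *)
have HS t : 0 <= t <= s.+1%:R * h -> (Lp_enorm p (finite_diff s.+1 t f0) <= (2 * omega)%:E)%E.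
  move=> /andP[]; rewrite le_eqVlt => /predU1P[<- _|t0 th].
    rewrite finite_diff_h0//.
    rewrite (_ : (fun=> 0) = (fun y => 0 * f0 y)); last by apply/funext => y; rewrite mul0r.
    rewrite (Lp_enormZ _ p0); last exact: borel_lmeasurable.
    by rewrite normr0 mul0e lee_fin mulr_ge0.
  apply: le_trans (Lp_enorm_finite_diffS s t p1 mf0 pf0) _.
  by rewrite EFinM lee_wpmul2l//; apply: Hs; rewrite t0.
pose G := smoothing s.+1 h f0; pose g := G 0%N.
have dG k : (k < s)%N -> forall y : R, is_derive y 1 (G k) (G k.+1 y).
  by move=> ks y; apply: smoothing_is_derive.
have cG k : (k <= s)%N -> continuous (G k).
  by move=> ks; apply: smoothing_continuous.
have mG k : (k <= s)%N -> measurable_fun setT (G k).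
  by move=> /cG; exact: continuous_measurable_fun.
have gE : (g^`(s))%classic = G s by exact: derive1n_smoothing.
have errM : (Lp_enorm p (fun y => f0 y - g y)%R <= (2 * omega)%:E)%E.
  exact: smoothing_error_le.
have GsM := Lp_enorm_smoothing_le p1 h0 f0L Hs.
have hs : 2 ^+ s.+1 * h ^- s * omega = C1 * n%:R ^+ s * omega.
  by rewrite /h exprVn invrK exprMn /C1 !mulrA.
rewrite {}hs -/G in GsM.
have pg : periodic g 1 by exact: smoothing_periodic.
have gL : borel_Lp p g.
  split => //; first exact: mG.
  rewrite (_ : g = fun y => f0 y - (f0 y - g y)); last first.
    by apply/funext => y; rewrite opprB addrC subrK.
  apply: le_lt_trans (Lp_enormB_le p1 mf0 _) _.
    by apply: measurable_funB => //; exact: mG.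
  by rewrite lte_add_pinfty// (le_lt_trans errM)// ltry.
exists g; split.
- split; last exact: gL.
  exact: (smoothing_in_W p1 s0 h0 f0L Hs).
- apply: (@le_trans _ _ (2 * omega)); last by rewrite ler_wpM2r// -addrA lerDl addr_ge0.
  apply: Lp_norm_le; rewrite (@Lp_enorm_ae R p _ (fun y => f0 y - g y))//.
    by apply: measurable_funB => //; exact: mG.
  by apply: negligibleS ff0 => y /=; apply: contra_not => ->.
- apply: (@le_trans _ _ (C1 * omega)); last by rewrite ler_wpM2r// addrAC lerDr addr_ge0.
  rewrite gE ler_pdivrMl ?exprn_gt0//.
  by apply: Lp_norm_le; rewrite mulrA (mulrC _ C1).
set delta := gamma / n%:R.
have delta0 : 0 < delta by rewrite divr_gt0.
have dn : delta ^+ s * n%:R ^+ s <= 1.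
  by rewrite -exprMn /delta divfK ?gt_eqF// exprn_ile1// ltW.
(* One function [w] collects both contributions to the local means, so that the
   estimate at the nodes is used only once. *)
pose w y := `|f0 y - g y| + delta ^+ s * `|G s y|.
have mfg : measurable_fun setT (fun y => f0 y - g y).
  by apply: measurable_funB => //; exact: mG.
have mw1 : measurable_fun setT (fun y => `|f0 y - g y|) by exact: measurableT_comp.
have mw2 : measurable_fun setT (fun y => `|G s y|).
  by apply: measurableT_comp => //; exact: mG.
have mw3 : measurable_fun setT (fun y => delta ^+ s * `|G s y|) by exact: measurable_funM.
have wM : (Lp_enorm p w <= ((2 + C1) * omega)%:E)%E.
  apply: le_trans (Lp_enormD p1 (borel_lmeasurable mw1) (borel_lmeasurable mw3)) _.
  rewrite (Lp_enormZ _ p0 (borel_lmeasurable mw2)) !Lp_enorm_norm mulrDl EFinD leeD//.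
  apply: le_trans (lee_wpmul2l _ GsM) _; first by rewrite lee_fin.
  rewrite -EFinM lee_fin ger0_norm ?exprn_ge0 ?(ltW delta0)//.
  rewrite (_ : _ * _ = (delta ^+ s * n%:R ^+ s) * (C1 * omega)); last by ring.
  by rewrite ler_piMl// mulr_ge0.
have wL : borel_Lp p w.
  split; first exact: measurable_funD.
    by move=> y; rewrite /w pf0 pg (_ : G s (y + 1) = G s y)//; exact: smoothing_periodic.
  exact: le_lt_trans wM (ltry _).
apply: (@le_trans _ _ (C3 * omega)); last by rewrite ler_wpM2r// lerDr addr_ge0.
have wn : Lp_norm p w <= (2 + C1) * omega by exact: Lp_norm_le.
rewrite /C3 -mulrA.
apply: (@le_trans _ _ (K * gamma^-1 `^ p^-1 * Lp_norm p w)); last first.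
  by rewrite ler_wpM2l// mulr_ge0// powR_ge0.
apply: (lp_norm_le_local_mean p1 n0 gamma0 K0 sx wL) => k kn.
set z := x n k; rewrite -/delta.
have gi := borel_Lp_interval_integrable p1 gL.
have fgi : interval_integrable (fun y => f0 y - g y).
  under eq_fun do rewrite -mulN1r.
  by apply: interval_integrableD => //; exact: interval_integrableZ.
have Gsi : interval_integrable (G s) by apply: continuous_interval_integrable; exact: cG.
rewrite /= (steklovB _ _ _ ff0 f0i gi) -addrA; apply: le_trans (ler_normD _ _) _.
have B1 := steklov_bound z delta0 r0 fgi.
have B2 : `|steklov delta r g z - g z| <=
   2 ^+ (2 * r - s) * delta ^+ s.-1 * \int[mu]_(t in `[z - delta / 2, z + delta / 2]) `|G s t|.
  have := @steklov_smooth_error R delta r s.-1 G z delta0 r0; rewrite prednK//; apply => //.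
    by move=> k' ks y; apply: dG; rewrite -(prednK s0) ltnS.
  exact: cG.
set I1 := (X in _ * X) in B1; set I2 := (X in _ * X) in B2.
have I10 : 0 <= I1 by apply: Rintegral_ge0.
have I20 : 0 <= I2 by apply: Rintegral_ge0.
have IE : \int[mu]_(t in `[z - delta / 2, z + delta / 2]) `|w t| = I1 + delta ^+ s * I2.
  have E : (fun t => `|w t|) = fun t => `|f0 t - g t| + delta ^+ s * `|G s t|.
    apply/funext => t; rewrite ger0_norm// /w addr_ge0// mulr_ge0// exprn_ge0//.
    exact: ltW.
  rewrite E RintegralD//; last 2 first.
  - exact/interval_integrableP/interval_integrable_norm.
  - exact/interval_integrableP/interval_integrableZ/interval_integrable_norm.
  by rewrite RintegralZl//; exact/interval_integrableP/interval_integrable_norm.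
rewrite IE mulrDr.
apply: lerD.
  apply: le_trans B1 _; rewrite ler_wpM2r// ler_wpM2r ?invr_ge0 ?(ltW delta0)//.
  by rewrite /K lerDl exprn_ge0.
apply: le_trans B2 _.
rewrite (_ : K / delta * (delta ^+ s * I2) = K * (delta ^+ s.-1 * I2)); last first.
  by rewrite -{1}(prednK s0) exprS; field; rewrite gt_eqF.
rewrite -mulrA ler_wpM2r//; first by rewrite mulr_ge0// exprn_ge0// ltW.
by rewrite /K lerDr !mulr_ge0 ?exprn_ge0.
Qed.
End approximation.

(** * Sampling operators *)

Section assembly.
Context {R : realType}.
Implicit Types (c p : R) (f g u v w : R -> R) (n : nat) (x : nat -> nat -> R).
Local Notation mu := (@lebesgue_measure R).

Lemma in_Lp_borel p f : 1 <= p -> in_Lp p f ->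
  exists2 f0 : R -> R, borel_Lp p f0 & {ae mu, forall y, f y = f0 y}.
Proof.
move=> p1 [mf pf fp]; have p0 : 0 < p by exact: lt_le_trans p1.
have [f0 [N [mf0 pf0 mN N0 fE]]] := borel_representative mf pf.
have ff0 : {ae mu, forall y, f y = f0 y}.
  by exists N; split => // y /=; apply: contra_notP; exact: fE.
by exists f0 => //; split => //; rewrite -(Lp_enorm_ae p0 mf0 ff0).
Qed.

Lemma borel_in_Lp p f : borel_Lp p f -> in_Lp p f.
Proof. by move=> [mf pf fp]; split => //; exact: borel_lmeasurable. Qed.

Lemma in_LpZ p c f : 1 <= p -> in_Lp p f -> in_Lp p (fun y => c * f y).
Proof.
move=> p1 [mf pf fp]; have p0 : 0 < p by exact: lt_le_trans p1.
split; last by rewrite (Lp_enormZ _ p0 mf) lte_mul_pinfty// lee_fin.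
- by apply: measurable_funM => //; exact: measurable_cst.
- by move=> y; rewrite pf.
Qed.

Lemma in_LpD p f g : 1 <= p -> in_Lp p f -> in_Lp p g -> in_Lp p (f \+ g).
Proof.
move=> p1 [mf pf fp] [mg pg gp]; split.
- exact: measurable_funD.
- by move=> y /=; rewrite pf pg.
- by apply: le_lt_trans (Lp_enormD p1 mf mg) _; exact: lte_add_pinfty.
Qed.

Lemma in_LpB p f g : 1 <= p -> in_Lp p f -> in_Lp p g -> in_Lp p (f \- g).
Proof.
move=> p1 fL gL; rewrite (_ : f \- g = f \+ (fun y => -1 * g y)).
  exact: (in_LpD p1 fL (in_LpZ _ p1 gL)).
by apply/funext => y /=; rewrite mulN1r.
Qed.

Lemma in_Lp_sampling p x (phi : nat -> nat -> R -> R) n u : 1 <= p ->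
  (forall k, (1 <= k <= n)%N -> in_Lp p (phi n k)) -> in_Lp p (sampling x phi n u).
Proof.
move=> p1 phiL; have p0 : 0 < p by exact: lt_le_trans p1.
suff H m : (m <= n)%N -> in_Lp p (fun t => \sum_(1 <= k < m.+1) u (x n k) * phi n k t).
  exact: H.
elim: m => [_|m IH mn].
  rewrite (_ : (fun=> _) = (fun y => 0 * (fun=> 0) y)); last first.
    by apply/funext => y; rewrite big_geq// mul0r.
  apply: borel_in_Lp; split => //.
  rewrite (Lp_enormZ _ p0); last by apply: borel_lmeasurable.
  by rewrite normr0 mul0e ltry.
rewrite (_ : (fun=> _) = (fun t => \sum_(1 <= k < m.+1) u (x n k) * phi n k t) \+
   (fun t => u (x n m.+1) * phi n m.+1 t)); last first.
  by apply/funext => y; rewrite big_nat_recr.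
exact: (in_LpD p1 (IH (ltnW mn)) (in_LpZ _ p1 (phiL m.+1 mn))).
Qed.

Lemma samplingB x phi n u v : sampling x phi n (u \- v) = sampling x phi n u \- sampling x phi n v.
Proof.
by apply/funext => t; rewrite /sampling /= -sumrB; apply: eq_bigr => k _; rewrite mulrBl.
Qed.

Lemma Lp_normD p f g : 1 <= p -> in_Lp p f -> in_Lp p g ->
  Lp_norm p (f \+ g) <= Lp_norm p f + Lp_norm p g.
Proof.
move=> p1 [mf _ fp] [mg _ gp]; apply: Lp_norm_le.
by rewrite EFinD !Lp_norm_fineK//; exact: Lp_enormD.
Qed.

Lemma Lp_normB p f g : 1 <= p -> in_Lp p f -> in_Lp p g ->
  Lp_norm p (f \- g) <= Lp_norm p f + Lp_norm p g.
Proof.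
move=> p1 fL gL; have p0 : 0 < p by exact: lt_le_trans p1.
have -> : Lp_norm p g = Lp_norm p (fun y => -1 * g y).
  by case: gL => mg _ _; rewrite /Lp_norm (Lp_enormZ _ p0 mg) normrN1 mul1e.
rewrite (_ : f \- g = f \+ (fun y => -1 * g y)); last first.
  by apply/funext => y /=; rewrite mulN1r.
exact: (Lp_normD p1 fL (in_LpZ _ p1 gL)).
Qed.

Lemma lp_norm_ge0 p x n u : 0 <= lp_norm p x n u.
Proof. exact: powR_ge0. Qed.

(** The sum is at most twice the larger term. *)
Lemma powR_add_le p (a b : R) : 1 <= p -> 0 <= a -> 0 <= b ->
  (a + b) `^ p <= 2 `^ p * (a `^ p + b `^ p).
Proof.
move=> p1; have p0 : 0 <= p by exact: le_trans p1.
wlog ab : a b / a <= b.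
  move=> H a0 b0; have [ab|/ltW ba] := leP a b; first exact: H.
  by rewrite (addrC a) (addrC (a `^ p)); exact: H.
move=> a0 b0; apply: (@le_trans _ _ ((2 * b) `^ p)).
  by apply: ge0_ler_powR; rewrite ?nnegrE ?addr_ge0 ?mulr_ge0//; lra.
by rewrite powRM// ler_wpM2l ?powR_ge0// lerDr powR_ge0.
Qed.

(** The factor 4 is harmless, as only the order of the discrete norms matters;
    it comes from [powR_add_le] at each node and from [2 <= 2 ^ p]. *)
Lemma lp_norm_triangle p x n u v w : 1 <= p ->
  (forall k, `|w (x n k)| <= `|u (x n k)| + `|v (x n k)|) ->
  lp_norm p x n w <= 4 * (lp_norm p x n u + lp_norm p x n v).
Proof.
move=> p1 H; have p0 : 0 < p by exact: lt_le_trans p1.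
rewrite /lp_norm; set S := fun f => n%:R^-1 * \sum_(1 <= k < n.+1) `|f (x n k)| `^ p.
rewrite -/(S w) -/(S u) -/(S v).
have S0 f : 0 <= S f by rewrite mulr_ge0// ?invr_ge0//; apply: sumr_ge0 => k _; exact: powR_ge0.
have SS : S w <= 2 `^ p * (S u + S v).
  rewrite /S -mulrDr mulrCA ler_wpM2l ?invr_ge0// -big_split/= mulr_sumr.
  apply: ler_sum => k _; apply: le_trans (powR_add_le p1 _ _) => //.
  by apply: ge0_ler_powR; rewrite ?nnegrE ?addr_ge0// ltW.
pose m := Num.max (S u) (S v).
have m0 : 0 <= m by rewrite le_max S0.
have Sm : S w <= 4 `^ p * m.
  apply: le_trans SS _; rewrite (_ : 4 = 2 * 2); last by rewrite -natrM.
  rewrite powRM// -mulrA ler_wpM2l ?powR_ge0//.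
  apply: (@le_trans _ _ (2 * m)).
    by rewrite mulr_natl mulr2n lerD// /m le_max lexx ?orbT.
  rewrite ler_wpM2r// -[leLHS]powRr1//.
  by apply: ler_powR => //; rewrite ler1n.
apply: (@le_trans _ _ (4 * m `^ p^-1)).
  have -> : 4 * m `^ p^-1 = (4 `^ p * m) `^ p^-1.
    by rewrite powRM ?powR_ge0// -powRrM mulfV ?gt_eqF// powRr1.
  apply: ge0_ler_powR; rewrite ?nnegrE ?invr_ge0 ?(ltW p0)//.
  by rewrite mulr_ge0// powR_ge0.
rewrite ler_wpM2l// /m; case: (leP (S u) (S v)) => _.
  by rewrite lerDr powR_ge0.
by rewrite lerDl powR_ge0.
Qed.
End assembly.

Theorem corollary4p2 (R : realType) (p : R) (r s : nat) (gamma : R)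
    (x : nat -> nat -> R) (phi : nat -> nat -> R -> R) (f : R -> R)
    (K1 K2 K3 : R) :
  1 <= p -> (0 < r)%N -> (0 < s)%N -> (s <= 2 * r)%N ->
  0 < gamma <= 1 -> separated_nodes gamma x ->
  (forall n k, (1 <= k <= n)%N -> in_Lp p (phi n k)) ->
  in_Lp p f ->
  0 < K1 -> 0 < K2 -> 0 < K3 ->
  (forall (g : R -> R) (n : nat), in_Lp p g -> (0 < n)%N ->
     K2 * lp_norm p x n g <= Lp_norm p (sampling x phi n g)
       <= K1 * lp_norm p x n g) ->
  (forall (g : R -> R) (n : nat), in_W p s g -> (0 < n)%N ->
     Lp_norm p (g \- sampling x phi n g)
       <= K3 * (n%:R ^+ s)^-1 * Lp_norm p (g^`(s))%classic) ->
  (fun n : nat => smoothness s p f n%:R^-1)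
    =o_\oo (fun n : nat => lp_norm p x n (steklov (gamma / n%:R) r f \- f)) ->
  exists c C : R, exists n0 : nat, [/\ 0 < c, 0 < C &
    forall n : nat, (n0 <= n)%N ->
      c * lp_norm p x n (steklov (gamma / n%:R) r f \- f)
        <= Lp_norm p (f \- sampling x phi n f)
        <= C * lp_norm p x n (steklov (gamma / n%:R) r f \- f)].
Proof.
move=> p1 r0 s0 sr gamma01 sx phiL fL K10 K20 K30 HG HW Ho.
have [f0 f0L ff0] := in_Lp_borel p1 fL.
have [C C0 HC] := smooth_approximation p1 r0 s0 sr gamma01 f0L ff0.
pose D := C * (1 + K3).
have D0 : 0 <= D by rewrite mulr_ge0// addr_ge0// ltW.
pose E := 4 * (D / K2 + C).
have E0 : 0 <= E by rewrite mulr_ge0// addr_ge0// divr_ge0// ltW.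
(* The lower bound has a remainder [E * omega]; this choice makes it at most
   half of the discrete norm. *)
pose eps := (2 * (E + 1))^-1.
have eps0 : 0 < eps by rewrite invr_gt0 mulr_gt0// ltr_wpDl.
move/eqoP : Ho => /(_ eps eps0) [n1 _ Hn1].
exists (K2 / 8), (D + 4 * K1 * (1 + C)), (maxn n1 1); split.
- by rewrite divr_gt0.
- by rewrite ltr_wpDl// !mulr_gt0// ltr_wpDr.
move=> n; rewrite geq_max => /andP[n1n n0].
have := Hn1 n n1n; rewrite /= (ger0_norm (lp_norm_ge0 _ _ _ _)).
set omega := smoothness s p f n%:R^-1.
set A := lp_norm p x n (steklov (gamma / n%:R) r f \- f) => /(le_trans (ler_norm _)) oA.
have A0 : 0 <= A by exact: lp_norm_ge0.
have [g [[gW gL] Hfg Hgs HFg]] := HC n x n0 sx.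
rewrite -/omega in Hfg Hgs HFg.
have gL' := borel_in_Lp gL.
have SL u : in_Lp p (sampling x phi n u) by apply: in_Lp_sampling => // k; exact: phiL.
have HgG : Lp_norm p (g \- sampling x phi n g) <= K3 * (C * omega).
  apply: le_trans (HW g n gW n0) _; rewrite -mulrA ler_wpM2l//; exact: ltW.
have /andP[Hlow Hup] := HG (g \- f) n (in_LpB p1 gL' fL) n0.
set q := lp_norm p x n (g \- f) in Hlow Hup.
set NG := Lp_norm p (sampling x phi n (g \- f)) in Hlow Hup.
set B := Lp_norm p (f \- sampling x phi n f).
have qA : q <= 4 * (A + C * omega).
  apply: (@le_trans _ _ (4 * (A + lp_norm p x n (steklov (gamma / n%:R) r f \- g)))).
    apply: lp_norm_triangle => // k /=.
    set F := steklov _ _ _ _; rewrite (_ : g _ - f _ = (F - f (x n k)) - (F - g (x n k))); last by ring.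
    exact: ler_normB.
  by rewrite ler_wpM2l// lerD2l.
have Aq : A <= 4 * (q + C * omega).
  apply: (@le_trans _ _ (4 * (q + lp_norm p x n (steklov (gamma / n%:R) r f \- g)))).
    apply: lp_norm_triangle => // k /=.
    set F := steklov _ _ _ _; rewrite (_ : F - f _ = (g (x n k) - f (x n k)) + (F - g (x n k))); last by ring.
    exact: ler_normD.
  by rewrite ler_wpM2l// lerD2l.
have fgL := in_LpB p1 fL gL'.
have gGL := in_LpB p1 gL' (SL g).
have fGL := in_LpB p1 fL (SL f).
have BNG : B <= D * omega + NG.
  rewrite /B (_ : f \- _ = ((f \- g) \+ (g \- sampling x phi n g)) \+ sampling x phi n (g \- f)).
    apply: le_trans (Lp_normD p1 (in_LpD p1 fgL gGL) (SL _)) _; rewrite lerD2r.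
    apply: le_trans (Lp_normD p1 fgL gGL) _.
    by apply: le_trans (lerD Hfg HgG) _; rewrite /D; lra.
  by rewrite samplingB; apply/funext => t /=; ring.
have NGB : NG <= D * omega + B.
  rewrite /NG (_ : sampling x phi n (g \- f) =
     (f \- sampling x phi n f) \- ((f \- g) \+ (g \- sampling x phi n g))).
    apply: le_trans (Lp_normB p1 fGL (in_LpD p1 fgL gGL)) _; rewrite addrC lerD2r.
    apply: le_trans (Lp_normD p1 fgL gGL) _.
    by apply: le_trans (lerD Hfg HgG) _; rewrite /D; lra.
  by rewrite samplingB; apply/funext => t /=; ring.
have epsE : eps * (2 * (E + 1)) = 1 by rewrite mulVf// gt_eqF// mulr_gt0// ltr_wpDl.
have EoA : E * omega <= A / 2.
  apply: le_trans (ler_wpM2l E0 oA) _.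
  rewrite mulrA -[A / 2]mulrC ler_wpM2r//.
  have : E * eps * 2 <= 1 by rewrite -epsE; nra.
  by lra.
have oA1 : omega <= A.
  apply: le_trans oA _; rewrite ler_piMl//.
  by rewrite invf_le1 ?mulr_gt0// ?ltr_wpDl//; lra.
apply/andP; split.
- have qB : q <= (D * omega + B) / K2.
    by rewrite ler_pdivlMr// mulrC (le_trans Hlow).
  have : A <= 4 / K2 * B + E * omega.
    apply: le_trans Aq _; rewrite /E.
    have := ler_wpM2l (ler0n R 4) qB; lra.
  move=> H; have {H} : A <= 8 / K2 * B by lra.
  by rewrite -ler_pdivrMl ?divr_gt0// invf_div.
- apply: le_trans BNG _; rewrite mulrDl; apply: lerD; first by rewrite ler_wpM2l.
  apply: le_trans Hup _.
  have : q <= 4 * (1 + C) * A.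
    apply: le_trans qA _; have := ler_wpM2l C0 oA1; lra.
  by move=> /(ler_wpM2l (ltW K10)); lra.
Qed.
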